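(* For all $\rho\in\mathfrak{P}_+$, $$d(\rho,I)\le\sqrt{2S(\rho)},$$ where $S(\rho)=\tau[\rho\log\rho]$.
   Context: Clifford algebra. Fix $n\ge 1$. On $\mathcal H=(\mathbb C^2)^{\otimes n}$ let $Q=\begin{pmatrix}0&1\\1&0\end{pmatrix}$, $U_0=\begin{pmatrix}1&0\\0&-1\end{pmatrix}$, and let $Q_j=U_0^{\otimes(j-1)}\otimes Q\otimes I^{\otimes(n-j)}$, so $Q_iQ_j+Q_jQ_i=2\delta_{ij}I$. Let $\mathfrak{C}$ be the complex algebra generated by $Q_1,\dots,Q_n$; it has basis $Q^{\alpha}=Q_1^{\alpha_1}\cdots Q_n^{\alpha_n}$, $\alpha\in\{0,1\}^n$, $|\alpha|=\sum_j\alpha_j$. Let $\tau=2^{-n}\operatorname{Tr}$. Calculus. $\Gamma$ is the linear map with $\Gamma(Q^\alpha)=(-1)^{|\alpha|}Q^\alpha$ (a $*$-automorphism). $\nabla_i(A)=\frac12(Q_iA-\Gamma(A)Q_i)$, $\nabla A=(\nabla_1A,\dots,\nabla_nA)\in\mathfrak{C}^n$; $\nabla_i^*(A)=\frac12(Q_iA+\Gamma(A)Q_i)$, and $\operatorname{div}(\mathbf A)=-\sum_i\nabla_i^*(A_i)$. Densities. $\mathfrak{P}_+$ is the set of strictly positive (positive and invertible) $\rho\in\mathfrak C$ with $\tau(\rho)=1$. For $\rho\in\mathfrak{P}_+$, $(\Gamma(\rho),\rho)\#C=\int_0^1\Gamma(\rho)^{1-s}C\rho^s\,\mathrm ds$,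 applied componentwise on $\mathfrak C^n$. Metric and distance. For $\rho\in\mathfrak P_+$ and a continuously differentiable curve in $\mathfrak{P}_+$ with $\rho(0)=\rho$ there is a unique gradient $\nabla U$ with $\dot\rho(0)+\operatorname{div}[(\Gamma(\rho),\rho)\#\nabla U]=0$; set $g_\rho(\dot\rho(0),\dot\rho(0))=\sum_i\tau[(\nabla_i U)^*(\Gamma(\rho),\rho)\#\nabla_i U]$. For $\rho_0,\rho_1\in\mathfrak P_+$, $$d(\rho_0,\rho_1)=\inf\int_0^1\sqrt{g_{\rho(t)}(\dot\rho(t),\dot\rho(t))}\,\mathrm dt,$$ the infimum being over all maps $\rho:[0,1]\to\mathfrak P_+$ that are continuous on $[0,1]$, smooth on $(0,1)$, with $\rho(0)=\rho_0$, $\rho(1)=\rho_1$. *)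

(* Defs.v *)
From mathcomp Require Import all_boot all_order all_algebra.
From mathcomp Require Import sesquilinear spectral complex.
From mathcomp Require Import all_classical all_reals all_analysis.

Set Implicit Arguments.
Unset Strict Implicit.
Unset Printing Implicit Defensive.

Import Order.TTheory GRing.Theory Num.Theory.
Import numFieldNormedType.Exports.
Local Open Scope classical_set_scope.
Local Open Scope sesquilinear_scope.
Local Open Scope complex_scope.
Local Open Scope ring_scope.

(* The computational basis of (C^2)^{(x) n} is indexed by {ffun 'I_n -> 'I_2},
   so that the tensor product of n operators on C^2 needs no dimension casts. *)
Definition hdim (n : nat) : nat := #|{ffun 'I_n -> 'I_2}|.

Section Clifford.
Variables (R : realType) (n : nat).
Local Notation C := R[i].
Local Notation op := 'M[C]_(hdim n).

Definition tensor (A : 'I_n -> 'M[C]_2) : op :=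
  \matrix_(a, b) \prod_(k < n)
    A k ((enum_val a : {ffun 'I_n -> 'I_2}) k)
        ((enum_val b : {ffun 'I_n -> 'I_2}) k).

Definition pauliQ : 'M[C]_2 := \matrix_(a, b) (if a == b then 0 else 1).

Definition pauliU : 'M[C]_2 := \matrix_(a, b) (if a == b then (-1) ^+ a else 0).

Definition Q (j : 'I_n) : op :=
  tensor (fun k => if (k < j)%N then pauliU else if k == j then pauliQ else 1%:M).

Inductive clifford : op -> Prop :=
| clifford_gen j : clifford (Q j)
| clifford_scalar c : clifford c%:M
| clifford_add A B : clifford A -> clifford B -> clifford (A + B)
| clifford_mul A B : clifford A -> clifford B -> clifford (A *m B).

Definition multi := {ffun 'I_n -> bool}.

Definition Qpow (alpha : multi) : op := \prod_(j < n) Q j ^+ alpha j.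

Definition tau (A : op) : C := (2 ^+ n)^-1 * \tr A.

(* The linear map with Gamma (Qpow alpha) = (-1)^|alpha| Qpow alpha, through
   coordinates in the basis (Qpow alpha); only meaningful on [clifford]. *)
Definition Gamma (A : op) : op :=
  \sum_(alpha : multi)
    ((-1) ^+ (\sum_j alpha j)%N * coord (codom_tuple Qpow) (enum_rank alpha) A)
      *: Qpow alpha.

Definition nabla (i : 'I_n) (A : op) : op := 2^-1 *: (Q i *m A - Gamma A *m Q i).

Definition nabla_adj (i : 'I_n) (A : op) : op :=
  2^-1 *: (Q i *m A + Gamma A *m Q i).

Definition grad (A : op) : {ffun 'I_n -> op} := [ffun i => nabla i A].

Definition div (W : {ffun 'I_n -> op}) : op := - \sum_i nabla_adj i (W i).

Definition positive (A : op) : Prop :=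
  forall x : 'cV[C]_(hdim n), 0 <= (x^t* *m A *m x) 0 0.

Definition density (rho : op) : Prop :=
  [/\ clifford rho, positive rho, rho \in unitmx & tau rho = 1].

(* Functional calculus for self-adjoint A: the eigenvalues [spectral_diag A]
   are then real, so that [complex.Re] loses nothing. *)
Definition fcalc (f : R -> R) (A : op) : op :=
  invmx (spectralmx A)
    *m diag_mx (map_mx (fun z => (f (complex.Re z))%:C) (spectral_diag A))
    *m spectralmx A.

Definition powmx (A : op) (s : R) : op := fcalc (fun x => x `^ s) A.

Definition logmx (A : op) : op := fcalc (@ln R) A.

(* Real-variable calculus for matrix-valued maps, applied to the real and
   imaginary parts of each entry. *)
Definition mxlift (L : (R -> R) -> R) (F : R -> op) : op :=
  \matrix_(a, b) (L (fun t => complex.Re (F t a b)) +i*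
                  L (fun t => complex.Im (F t a b))).

Definition mxall (P : (R -> R) -> Prop) (F : R -> op) : Prop :=
  forall a b, P (fun t => complex.Re (F t a b)) /\
              P (fun t => complex.Im (F t a b)).

Definition mxint01 : (R -> op) -> op :=
  mxlift (fun f => \int[lebesgue_measure]_(s in `[0, 1]) f s)%R.

Definition mxderive (F : R -> op) (t : R) : op := mxlift (fun f => (f^`())%classic t) F.

Definition smooth01 (F : R -> op) : Prop :=
  mxall (fun f => forall (k : nat) (t : R), 0 < t < 1 -> derivable (f^`(k))%classic t 1) F.

Definition continuous01 (F : R -> op) : Prop :=
  mxall (fun f => {within `[0, 1], continuous f}) F.

Definition sharp (A B X : op) : op :=
  mxint01 (fun s => powmx A (1 - s) *m X *m powmx B s).

Definition sharpn (A B : op) (W : {ffun 'I_n -> op}) : {ffun 'I_n -> op} :=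
  [ffun i => sharp A B (W i)].

Definition is_tangent_gradient (rho v : op) (W : {ffun 'I_n -> op}) : Prop :=
  (exists2 U, clifford U & W = grad U) /\
  v + div (sharpn (Gamma rho) rho W) = 0.

(* The default value 0 is never used when v is the velocity of a curve of
   densities through rho: the gradient then exists and is unique. *)
Definition tangent_gradient (rho v : op) : {ffun 'I_n -> op} :=
  xget 0 [set W | is_tangent_gradient rho v W].

(* The sum is a nonnegative real number; [complex.Re] only changes its type. *)
Definition metric (rho v : op) : R :=
  let W := tangent_gradient rho v in
  complex.Re (\sum_i tau ((W i)^t* *m sharp (Gamma rho) rho (W i))).

Definition admissible (rho0 rho1 : op) (rho : R -> op) : Prop :=
  [/\ forall t, 0 <= t <= 1 -> density (rho t),
      continuous01 rho, smooth01 rho, rho 0 = rho0 & rho 1 = rho1].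

Definition curve_length (rho : R -> op) : \bar R :=
  (\int[lebesgue_measure]_(t in `]0%R, 1%R[)
     (Num.sqrt (metric (rho t) (mxderive rho t)))%:E)%E.

Definition dist (rho0 rho1 : op) : \bar R :=
  ereal_inf [set curve_length rho | rho in admissible rho0 rho1].

Definition entropy (rho : op) : R := complex.Re (tau (rho *m logmx rho)).

End Clifford.

(* Main.v *)
Require Import Defs.
From mathcomp Require Import all_boot all_order all_algebra.
From mathcomp Require Import sesquilinear spectral complex.
From mathcomp Require Import all_classical all_reals all_analysis.
From mathcomp Require Import measurable_realfun.
From mathcomp Require Import ring lra.

(** Let N be the number operator, which multiplies a monomial of degree d in the
    generators by d, and let rho_r = r^N rho. This polynomial curve joins the
    identity (r = 0) to rho (r = 1), and the theorem follows by estimating its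
    length.

    Speed. On the algebra, Gamma is the conjugation by a grading operator p
    ([Gamma_clifford]). In eigenbases of Gamma(rho) and rho the operation # is
    entrywise multiplication by logarithmic means, which turn differences of
    logarithms into differences of eigenvalues; hence the chain rule
    (Gamma(rho), rho) # nabla (log rho) = nabla rho ([sharp_grad_log]). Since
    div nabla = - N, the velocity of the curve at rho_r is represented by the
    gradient of log rho_r / r up to sign, and its squared speed is
    G(r) = I(rho_r) / r^2 with I the Fisher information
    ([metric_gradient_flow]).

    Monotonicity of G. The Fisher information is an integral over s in [0, 1] of
    the suprema over Y of
      2 <X, Y> - s <Y, Gamma(rho) Y> - (1 - s) <Y, Y rho>,  X = nabla rho,
    which are jointly convex in (rho, X) and invariant under automorphisms. The
    operator x^N is an average of automorphisms that commute with Gamma: the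
    sign change sigma_i of one generator is conjugation by q_i p, and x^N is the
    product of the maps (1 + x)/2 + (1 - x)/2 sigma_i. As
    nabla x^N = x x^N nabla, it follows that I(x^N rho) <= x^2 I(rho)
    ([fisher_mix]), that is, G is nondecreasing.

    Entropy. The derivative of S(rho_r) in r is r G(r). Only the lower bound is
    needed, up to an error of second order, and it follows from Klein's
    inequality ([entropy_flow_growth]).

    Conclusion. For g the square root of G, monotonicity gives
      (int_0^1 g)^2 = 2 int_0^1 g(r) (int_0^r g) dr
                   <= 2 int_0^1 r g(r)^2 dr <= 2 S(rho),
    where the left side is the squared length ([length_le_sqrt]). *)

Set Implicit Arguments.
Unset Strict Implicit.
Unset Printing Implicit Defensive.

Import Order.TTheory GRing.Theory Num.Theory.
Import numFieldNormedType.Exports.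
Local Open Scope classical_set_scope.
Local Open Scope sesquilinear_scope.
Local Open Scope complex_scope.
Local Open Scope ring_scope.

(** * Real and imaginary parts, adjoints, the Hilbert-Schmidt product *)

Section RealParts.
Variable R : realType.
Local Notation C := R[i].
Implicit Types z w : C.

Lemma conjCE z : Num.conj z = conjc z.
Proof. by []. Qed.

Lemma ReD z w : complex.Re (z + w) = complex.Re z + complex.Re w.
Proof. by case: z => a b; case: w. Qed.

Lemma ImD z w : complex.Im (z + w) = complex.Im z + complex.Im w.
Proof. by case: z => a b; case: w. Qed.

Lemma ReM z w : complex.Re (z * w) =
  complex.Re z * complex.Re w - complex.Im z * complex.Im w.
Proof. by case: z => a b; case: w. Qed.

Lemma ImM z w : complex.Im (z * w) =
  complex.Re z * complex.Im w + complex.Im z * complex.Re w.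
Proof. by case: z => a b; case: w. Qed.

Lemma ReZ (a : R) z : complex.Re (a%:C * z) = a * complex.Re z.
Proof. by rewrite ReM /= mul0r subr0. Qed.

Lemma ImZ (a : R) z : complex.Im (a%:C * z) = a * complex.Im z.
Proof. by rewrite ImM /= mul0r addr0. Qed.

Lemma Re_sum I (r : seq I) (P : pred I) (F : I -> C) :
  complex.Re (\sum_(i <- r | P i) F i) = \sum_(i <- r | P i) complex.Re (F i).
Proof. by apply: (big_morph _ ReD). Qed.

Lemma Im_sum I (r : seq I) (P : pred I) (F : I -> C) :
  complex.Im (\sum_(i <- r | P i) F i) = \sum_(i <- r | P i) complex.Im (F i).
Proof. by apply: (big_morph _ ImD). Qed.

Lemma Re_conj z : complex.Re (Num.conj z) = complex.Re z.
Proof. by rewrite conjCE; case: z. Qed.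

Lemma Im_conj z : complex.Im (Num.conj z) = - complex.Im z.
Proof. by rewrite conjCE; case: z. Qed.

Lemma complex_eqP z w :
  complex.Re z = complex.Re w -> complex.Im z = complex.Im w -> z = w.
Proof. by case: z => a b; case: w => c d /= -> ->. Qed.

Lemma conj_real (a : R) : Num.conj (a%:C) = a%:C :> C.
Proof. by rewrite conjCE /= oppr0. Qed.

Definition sqmod z : R := complex.Re z ^+ 2 + complex.Im z ^+ 2.

Lemma sqmod_ge0 z : 0 <= sqmod z.
Proof. by rewrite addr_ge0 ?sqr_ge0. Qed.

Lemma sqmod_eq0 z : (sqmod z == 0) = (z == 0).
Proof.
rewrite paddr_eq0 ?sqr_ge0 // !sqrf_eq0.
by case: z => a b; rewrite eq_complex.
Qed.

Lemma sqmodE z : (sqmod z)%:C = z^* * z.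
Proof.
apply: complex_eqP; rewrite ?ReM ?ImM ?Re_conj ?Im_conj /sqmod /=; ring.
Qed.

End RealParts.

Lemma adjmxM (C : numClosedFieldType) m n p (A : 'M[C]_(m, n)) (B : 'M[C]_(n, p)) :
  (A *m B)^t* = B^t* *m A^t*.
Proof. by rewrite trmx_mul map_mxM. Qed.

Section MatrixAdjoint.
Variables (R : realType).
Local Notation C := R[i].

Lemma adjmxD m n (A B : 'M[C]_(m, n)) : (A + B)^t* = A^t* + B^t*.
Proof. by apply/matrixP=> i j; rewrite !mxE rmorphD. Qed.

Lemma adjmx1 n : (1%:M : 'M[C]_n)^t* = 1%:M.
Proof. by rewrite trmx1 map_mx1. Qed.

Lemma unitary_mulV n (S : 'M[C]_n) : S \is unitarymx -> S *m S^t* = 1%:M.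
Proof. by move/unitarymxP. Qed.

Lemma unitary_mulVl n (S : 'M[C]_n) : S \is unitarymx -> S^t* *m S = 1%:M.
Proof. by move=> uS; rewrite -(invmx_unitary uS) mulVmx ?unitarymx_unit. Qed.

(** Operators form a real inner product space under it, which is all that the
    variational argument uses. *)
Definition hsdot n (X Y : 'M[C]_n) : R := complex.Re (\tr (X^t* *m Y)).

Lemma hsdotE n (X Y : 'M[C]_n) : hsdot X Y =
  \sum_i \sum_j (complex.Re (X i j) * complex.Re (Y i j)
               + complex.Im (X i j) * complex.Im (Y i j)).
Proof.
rewrite /hsdot /mxtrace Re_sum exchange_big /=; apply: eq_bigr => j _.
rewrite mxE Re_sum; apply: eq_bigr => i _.
by rewrite !mxE ReM Re_conj Im_conj mulNr opprK.
Qed.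

Lemma hsdotC n (X Y : 'M[C]_n) : hsdot X Y = hsdot Y X.
Proof.
rewrite !hsdotE; apply: eq_bigr => i _; apply: eq_bigr => j _.
by rewrite [in RHS]mulrC [X in _ + X]mulrC.
Qed.

Lemma hsdotDl n (X Y Z : 'M[C]_n) : hsdot (X + Y) Z = hsdot X Z + hsdot Y Z.
Proof. by rewrite /hsdot adjmxD mulmxDl mxtraceD ReD. Qed.

Lemma hsdotDr n (X Y Z : 'M[C]_n) : hsdot Z (X + Y) = hsdot Z X + hsdot Z Y.
Proof. by rewrite /hsdot mulmxDr mxtraceD ReD. Qed.

Lemma hsdotZr n (a : R) (X Z : 'M[C]_n) : hsdot Z (a%:C *: X) = a * hsdot Z X.
Proof. by rewrite /hsdot -scalemxAr mxtraceZ ReZ. Qed.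

Lemma hsdotZl n (a : R) (X Z : 'M[C]_n) : hsdot (a%:C *: X) Z = a * hsdot X Z.
Proof. by rewrite hsdotC hsdotZr hsdotC. Qed.

Lemma hsdot_sumr n I (r : seq I) (P : pred I) (F : I -> 'M[C]_n) Z :
  hsdot Z (\sum_(i <- r | P i) F i) = \sum_(i <- r | P i) hsdot Z (F i).
Proof.
apply: (big_morph (hsdot Z) (fun X Y => hsdotDr X Y Z)).
by rewrite /hsdot mulmx0 mxtrace0.
Qed.

Lemma hsdotMl n (A X Y : 'M[C]_n) : hsdot (A *m X) Y = hsdot X (A^t* *m Y).
Proof. by rewrite /hsdot adjmxM mulmxA. Qed.

Lemma hsdotMr n (A X Y : 'M[C]_n) : hsdot (X *m A) Y = hsdot X (Y *m A^t*).
Proof. by rewrite /hsdot adjmxM mulmxA mxtrace_mulC !mulmxA mxtrace_mulC mulmxA. Qed.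

Lemma hsdot_unitary n (T S X Y : 'M[C]_n) :
  T \is unitarymx -> S \is unitarymx ->
  hsdot (T *m X *m S^t*) (T *m Y *m S^t*) = hsdot X Y.
Proof.
move=> uT uS; rewrite hsdotMr hsdotMl trmxCK -!mulmxA (unitary_mulVl uS) mulmx1.
by rewrite mulmxA (unitary_mulVl uT) mul1mx.
Qed.

Lemma hsdotxx n (X : 'M[C]_n) : hsdot X X = \sum_i \sum_j sqmod (X i j).
Proof. by rewrite hsdotE. Qed.

End MatrixAdjoint.

(** * Unitary diagonalisation and functional calculus *)

Section Spectral.
Variables (R : realType) (N : nat).
Local Notation C := R[i].

Definition rdiag (b : 'I_N -> R) : 'M[C]_N := diag_mx (\row_i (b i)%:C).

(** The unitary is a parameter, not a chosen eigenbasis, so that conjugates of a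
    diagonalised matrix come diagonalised with the same eigenvalues. *)
Definition spec (S : 'M[C]_N) (b : 'I_N -> R) : 'M[C]_N :=
  S^t* *m rdiag b *m S.

Lemma rdiag_mulE m (b : 'I_N -> R) (A : 'M[C]_(N, m)) i j :
  (rdiag b *m A) i j = (b i)%:C * A i j.
Proof. by rewrite mul_diag_mx !mxE. Qed.

Lemma mul_rdiagE m (b : 'I_N -> R) (A : 'M[C]_(m, N)) i j :
  (A *m rdiag b) i j = (b j)%:C * A i j.
Proof. by rewrite mul_mx_diag !mxE mulrC. Qed.

Lemma rdiag_mul u v : rdiag u *m rdiag v = rdiag (fun i => u i * v i).
Proof. by apply/matrixP=> i j; rewrite rdiag_mulE !mxE mulrnAr rmorphM. Qed.

Lemma rdiagD u v : rdiag u + rdiag v = rdiag (fun i => u i + v i).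
Proof. by apply/matrixP=> i j; rewrite !mxE -mulrnDl rmorphD. Qed.

Lemma rdiagZ (c : R) u : c%:C *: rdiag u = rdiag (fun i => c * u i).
Proof. by apply/matrixP=> i j; rewrite !mxE mulrnAr rmorphM. Qed.

Lemma eq_rdiag u v : u =1 v -> rdiag u = rdiag v.
Proof. by move=> uv; apply/matrixP=> i j; rewrite !mxE uv. Qed.

Lemma rdiag_adj u : (rdiag u)^t* = rdiag u.
Proof.
apply/matrixP=> i j; rewrite !mxE eq_sym rmorphMn /= conj_real.
by case: eqP => [->|].
Qed.

Lemma unitary_cancel m p (S : 'M[C]_N) (X : 'M[C]_(m, N)) (Y : 'M[C]_(N, p)) :
  S \is unitarymx -> X *m S *m (S^t* *m Y) = X *m Y.
Proof. by move=> uS; rewrite mulmxA -[X *m S *m _]mulmxA unitary_mulV // mulmx1. Qed.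

Lemma spec_mul S u v : S \is unitarymx ->
  spec S u *m spec S v = spec S (fun i => u i * v i).
Proof.
move=> uS; rewrite /spec -rdiag_mul.
by rewrite -[S^t* *m rdiag v *m S]mulmxA unitary_cancel // !mulmxA.
Qed.

Lemma spec_add S u v : spec S u + spec S v = spec S (fun i => u i + v i).
Proof. by rewrite /spec -mulmxDl -mulmxDr rdiagD. Qed.

Lemma spec_scale S (c : R) u : c%:C *: spec S u = spec S (fun i => c * u i).
Proof. by rewrite /spec -rdiagZ scalemxAl scalemxAr. Qed.

Lemma spec_const S (c : R) : S \is unitarymx -> spec S (fun=> c) = c%:C%:M.
Proof.
move=> uS; rewrite /spec.
have -> : rdiag (fun=> c) = c%:C%:M by apply/matrixP=> i j; rewrite !mxE.
by rewrite mul_mx_scalar -scalemxAl (unitary_mulVl uS) scalemx1.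
Qed.

Lemma eq_spec S u v : u =1 v -> spec S u = spec S v.
Proof. by move=> uv; rewrite /spec (eq_rdiag uv). Qed.

Lemma spec_adj S u : (spec S u)^t* = spec S u.
Proof. by rewrite /spec !adjmxM trmxCK rdiag_adj mulmxA. Qed.

Lemma spec_conj V S u : spec (S *m V^t*) u = V *m spec S u *m V^t*.
Proof. by rewrite /spec adjmxM trmxCK !mulmxA. Qed.

(** Two diagonalisations of one matrix differ by a unitary that only mixes
    equal eigenvalues, so it also intertwines any function of them. *)
Lemma spec_intertwine S b T c : S \is unitarymx -> T \is unitarymx ->
  spec S b = spec T c ->
  forall f, spec S (f \o b) = spec T (f \o c).
Proof.
move=> uS uT eST f; pose M := S *m T^t*.
have rot d X : rdiag d *m M = M *m rdiag X -> spec S d = spec T X.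
  move=> e; have := congr1 (fun Y => S^t* *m Y *m T) e.
  rewrite /spec /M !mulmxA (unitary_mulVl uS) mul1mx => <-.
  by rewrite -[_ *m T^t* *m T]mulmxA (unitary_mulVl uT) mulmx1.
have eD : rdiag b *m M = M *m rdiag c.
  have := congr1 (fun X => S *m X *m T^t*) eST.
  rewrite /spec /M !mulmxA (unitary_mulV uS) mul1mx => ->.
  by rewrite -[_ *m T *m T^t*]mulmxA (unitary_mulV uT) mulmx1.
apply: rot; apply/matrixP=> i j; rewrite rdiag_mulE mul_rdiagE /=.
have := congr1 (fun X : 'M[C]_N => X i j) eD; rewrite rdiag_mulE mul_rdiagE.
have [->|M0] := eqVneq (M i j) 0; first by rewrite !mulr0.
by move=> /(mulIf M0)/complexI ->.
Qed.

Lemma hermitian_spec (A : 'M[C]_N) : A^t* = A ->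
  exists S b, [/\ S \is unitarymx, A = spec S b,
    S = spectralmx A & forall i, b i = complex.Re (spectral_diag A 0 i)].
Proof.
move=> hA; have herm : A \is hermsymmx.
  by apply/is_hermitianmxP; rewrite expr0 scale1r; rewrite -[in LHS]hA.
have rD := hermitian_spectral_diag_real herm.
exists (spectralmx A), (fun i => complex.Re (spectral_diag A 0 i)).
split=> //; first exact: spectral_unitarymx.
have /hermitian_normalmx/orthomx_spectralP := herm.
rewrite (invmx_unitary (spectral_unitarymx A)) /spec /rdiag.
set d := \row_i _; suff -> : d = spectral_diag A by [].
by apply/rowP=> i; rewrite !mxE RRe_real //; apply: (mxOverP rD).
Qed.

End Spectral.

(** By [spec_intertwine], a function of a matrix may be computed in whichever
    eigenbasis is at hand. *)
Lemma fcalc_spec (R : realType) n (S : 'M[R[i]]_(hdim n)) b f : S \is unitarymx ->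
  fcalc f (spec S b) = spec S (f \o b).
Proof.
move=> uS; have [T [c [uT eT T_ c_]]] := hermitian_spec (spec_adj S b).
rewrite (spec_intertwine uS uT eT) /fcalc -T_ (invmx_unitary uT).
have -> : map_mx (fun z => (f (complex.Re z))%:C) (spectral_diag (spec S b)) =
    \row_i ((f \o c) i)%:C by apply/rowP=> i; rewrite !mxE /= c_.
by [].
Qed.

(** * Positive matrices *)

Section QuadraticForm.
Variables (C : numClosedFieldType) (N : nat).

Definition qform (A : 'M[C]_N) (x y : 'cV[C]_N) : C := (x^t* *m A *m y) 0 0.

Lemma qform_expand A x y d : qform A (x + d *: y) (x + d *: y) =
  qform A x x + d * qform A x y
  + (Num.conj d * qform A y x + (Num.conj d * d) * qform A y y).
Proof.
rewrite /qform; have -> : (x + d *: y)^t* = x^t* + Num.conj d *: y^t*.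
  by apply/matrixP=> i j; rewrite !mxE rmorphD rmorphM.
rewrite 2!mulmxDl !mulmxDr -[(_ *: _) *m A]scalemxAl -!scalemxAr -!scalemxAl.
by rewrite !mxE mulrA [d * Num.conj d]mulrC.
Qed.

End QuadraticForm.

Section Positive.
Variables (R : realType) (n : nat).
Local Notation C := R[i].
Local Notation op := 'M[C]_(hdim n).

Lemma positiveD (A B : op) : positive A -> positive B -> positive (A + B).
Proof.
by move=> pA pB x; rewrite mulmxDr mulmxDl mxE addr_ge0.
Qed.

Lemma positiveZ (c : R) (A : op) : 0 <= c -> positive A -> positive (c%:C *: A).
Proof.
move=> c0 pA x; rewrite -scalemxAr -scalemxAl mxE mulr_ge0 //.
by rewrite ler0c.
Qed.

Lemma positive_conj (V A : op) : positive A -> positive (V *m A *m V^t*).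
Proof.
move=> pA x; have := pA (V^t* *m x).
by rewrite adjmxM trmxCK !mulmxA.
Qed.

Lemma qform_delta (A : op) (i j : 'I_(hdim n)) :
  (delta_mx i 0 : 'cV[C]_(hdim n))^t* *m A *m (delta_mx j 0 : 'cV[C]_(hdim n)) =
  (A i j)%:M.
Proof.
have -> : (delta_mx i 0 : 'cV[C]_(hdim n))^t* = delta_mx 0 i.
  by apply/matrixP=> a b; rewrite !mxE ord1 eqxx andbT /= rmorph_nat.
rewrite -rowE -colE; apply/matrixP=> a b.
by rewrite !mxE !ord1 eqxx.
Qed.

Lemma qform_delta_mx (A : op) i j : qform A (delta_mx i 0) (delta_mx j 0) = A i j.
Proof. by rewrite /qform qform_delta mxE eqxx. Qed.

(** Polarisation with x = e_j + d e_i, for d = 1 and d = 'i, reads off both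
    parts of A i j from values of the form, which are real. *)
Lemma positive_adj (A : op) : positive A -> A^t* = A.
Proof.
move=> pA; apply/matrixP=> i j; rewrite !mxE.
have qI x : complex.Im (qform A x x) = 0 by apply: ger0_Im; apply: pA.
have diag k : complex.Im (A k k) = 0 by rewrite -qform_delta_mx.
have pol d : complex.Im (d * A j i + Num.conj d * A i j) = 0.
  have := qI (delta_mx j 0 + d *: delta_mx i 0); rewrite qform_expand.
  rewrite (qform_delta_mx A j j) (qform_delta_mx A j i) (qform_delta_mx A i j).
  by rewrite (qform_delta_mx A i i) -sqmodE !ImD ImZ !diag mulr0 add0r addr0.
have := pol 1; have := pol (0 +i* 1).
rewrite rmorph1 !mul1r conjCE.
case: (A j i) => a b; case: (A i j) => c d /=.
by move=> h1 h2; congr (_ +i* _); lra.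
Qed.

Lemma qform_spec (S : op) b (x : 'cV[C]_(hdim n)) :
  (x^t* *m spec S b *m x) 0 0 = \sum_i (b i * sqmod ((S *m x) i 0))%:C.
Proof.
rewrite /spec !mulmxA -adjmxM -[_ *m S *m x]mulmxA.
rewrite mxE; apply: eq_bigr => i _.
by rewrite mul_rdiagE rmorphM /= sqmodE -mulrA; congr (_ * (_ * _)); rewrite 2!mxE.
Qed.

Lemma positive_spec (S : op) b : (forall i, 0 <= b i) -> positive (spec S b).
Proof.
move=> b0 x; rewrite qform_spec sumr_ge0 // => i _.
by rewrite ler0c mulr_ge0 // sqmod_ge0.
Qed.

Lemma spec_positive (S : op) b : S \is unitarymx -> positive (spec S b) ->
  forall i, 0 <= b i.
Proof.
move=> uS pS i; have := pS (S^t* *m delta_mx i 0); rewrite qform_spec.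
rewrite mulmxA (unitary_mulV uS) mul1mx (bigD1 i) //= big1 => [|j ji].
  by rewrite addr0 !mxE !eqxx /sqmod /= expr0n /= expr1n addr0 mulr1 ler0c.
by rewrite !mxE (negPf ji) /sqmod /= expr0n /= addr0 mulr0.
Qed.

Lemma spec_lower_bound (S : op) b (c : R) : S \is unitarymx ->
  positive (spec S b - c%:C%:M) -> forall i, c <= b i.
Proof.
move=> uS; rewrite -(spec_const c uS).
have -> : spec S b - spec S (fun=> c) = spec S (fun i => b i - c).
  rewrite -[LHS]/(_ + _) -scaleN1r.
  have -> : (-1 : C) = (-1)%:C by rewrite rmorphN rmorph1.
  by rewrite spec_scale spec_add; apply: eq_spec => i; rewrite mulN1r.
by move=> p i; rewrite -subr_ge0; apply: (spec_positive uS p).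
Qed.

(** A kernel vector would be an eigenvector with eigenvalue 0, so an invertible
    positive matrix has positive eigenvalues only. *)
Lemma positive_unit_spec (A : op) : positive A -> A \in unitmx ->
  exists S b, [/\ S \is unitarymx, A = spec S b & forall i, 0 < b i].
Proof.
move=> pA uA; have [S [b [uS eA _ _]]] := hermitian_spec (positive_adj pA).
exists S, b; split=> // i; rewrite lt_neqAle (spec_positive uS) -?eA // andbT.
apply/eqP => bi0; have eX : A *m (S^t* *m delta_mx i 0) = 0 :> 'cV_(hdim n).
  rewrite eA /spec !mulmxA -[_ *m S *m S^t*]mulmxA (unitary_mulV uS) mulmx1 -mulmxA.
  apply/matrixP=> k l; rewrite mxE mxE big1 // => j _.
  rewrite rdiag_mulE !mxE; case: eqP => [->|_]; last by rewrite !mulr0.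
  by rewrite -bi0 mul0r mulr0.
have := congr1 (fun X => S *m (invmx A *m X)) eX.
rewrite mulKmx // mulmxA (unitary_mulV uS) mul1mx !mulmx0 => /matrixP/(_ i 0).
by rewrite !mxE !eqxx => /eqP; rewrite oner_eq0.
Qed.

Lemma spec_unit (S : op) b : S \is unitarymx -> (forall i, 0 < b i) ->
  spec S b \in unitmx.
Proof.
move=> uS b0; have e1 : spec S b *m spec S (fun i => (b i)^-1) = 1%:M.
  rewrite spec_mul // -[1%:M]/(1%:C%:M) -(spec_const 1 uS).
  by apply: eq_spec => i; rewrite mulfV // gt_eqF.
exact: (mulmx1_unit e1).1.
Qed.

End Positive.

(** * Logarithms and logarithmic means *)

Section RealAnalysis.
Variable R : realType.

Lemma is_derive_bigsum I (r : seq I) (f : I -> R -> R) (df : I -> R) (x : R) :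
  (forall i, is_derive x 1 (f i) (df i)) ->
  is_derive x 1 (fun s => \sum_(i <- r) f i s) (\sum_(i <- r) df i).
Proof.
move=> fd; elim: r => [|i r IH].
  rewrite big_nil (_ : (fun s => _) = cst 0); last first.
    by apply/funext => s; rewrite big_nil.
  exact: is_derive_cst.
rewrite big_cons (_ : (fun s => _) = f i + (fun s => \sum_(i <- r) f i s)).
  exact: is_deriveD.
by apply/funext => s; rewrite big_cons.
Qed.

Lemma is_derive_affine (a b s : R) :
  is_derive s 1 (fun s => s * a + (1 - s) * b) (a - b).
Proof.
rewrite (_ : (fun s => _) = cst b + (a - b) \*: (id : R -> R)).
  apply: is_derive_eq; rewrite add0r -[RHS]mulr1 //.
by apply/funext => t; rewrite -[RHS]/(b + (a - b) * t); ring.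
Qed.

Lemma interp_gt0 (s x y : R) : 0 <= s <= 1 -> 0 < x -> 0 < y -> 0 < s * x + (1 - s) * y.
Proof.
move=> /andP[s0 s1] x0 y0; have [->|sn0] := eqVneq s 0.
  by rewrite mul0r add0r subr0 mul1r.
apply: ltr_pwDl; first by rewrite mulr_gt0 // lt0r sn0.
by rewrite mulr_ge0 ?subr_ge0 // ltW.
Qed.

Definition log_interp (I : finType) (w a b : I -> R) (s : R) : R :=
  \sum_i w i * (a i - b i) * ln (s * a i + (1 - s) * b i).

(** This derivative is the integrand of the integral representation of
    (b - a)(ln b - ln a) used in [log_difference_le]. *)
Lemma is_derive_log_interp (I : finType) (w a b : I -> R) (s : R) :
  0 <= s <= 1 -> (forall i, 0 < a i) -> (forall i, 0 < b i) ->
  is_derive s 1 (log_interp w a b)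
    (\sum_i w i * (b i - a i) ^+ 2 / (s * a i + (1 - s) * b i)).
Proof.
move=> s01 a0 b0; apply: is_derive_bigsum => i.
have c0 := interp_gt0 s01 (a0 i) (b0 i).
have dl := @is_derive1_comp R _ (fun s => s * a i + (1 - s) * b i) s _ _
  (is_derive1_ln c0) (is_derive_affine (a i) (b i) s).
have dk := is_deriveZ (w i * (a i - b i)) dl.
apply: is_derive_eq dk _; rewrite /GRing.scale /=.
by field; rewrite gt_eqF.
Qed.

(** (b - a)(ln b - ln a) is the integral over s in [0, 1] of
    (b - a)^2 / (s a + (1 - s) b), so that a comparison for every s carries
    over; the integral is read off as the increment of an antiderivative. *)
Lemma log_difference_le (I J : finType) (w a b : I -> R) (w' a' b' : J -> R) :
  (forall i, 0 < a i) -> (forall i, 0 < b i) ->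
  (forall i, 0 < a' i) -> (forall i, 0 < b' i) ->
  (forall s : R, 0 <= s <= 1 ->
    \sum_j w' j * (b' j - a' j) ^+ 2 / (s * a' j + (1 - s) * b' j) <=
    \sum_i w i * (b i - a i) ^+ 2 / (s * a i + (1 - s) * b i)) ->
  \sum_j w' j * (b' j - a' j) * (ln (b' j) - ln (a' j)) <=
  \sum_i w i * (b i - a i) * (ln (b i) - ln (a i)).
Proof.
move=> a0 b0 a'0 b'0 H.
pose D : R -> R := log_interp w a b - log_interp w' a' b'.
have dD (s : R) : 0 <= s <= 1 -> is_derive s 1 D
    (\sum_i w i * (b i - a i) ^+ 2 / (s * a i + (1 - s) * b i)
    - \sum_j w' j * (b' j - a' j) ^+ 2 / (s * a' j + (1 - s) * b' j)).
  by move=> s01; apply: is_deriveB; apply: is_derive_log_interp.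
have inc : D 0 <= D 1.
  apply: (@ger0_derive1_le_cc R D 0 1) => //; rewrite ?in_itv /= ?lexx ?ler01 //.
  - move=> x /[!in_itv]/= /andP[x0 x1].
    by apply: ex_derive; apply: dD; rewrite !ltW.
  - move=> x /[!in_itv]/= /andP[x0 x1].
    have x01 : 0 <= x <= 1 by rewrite !ltW.
    have dx := dD _ x01; rewrite derive1E derive_val subr_ge0; exact: H.
  - apply: derivable_within_continuous => x /[!in_itv]/= x01.
    by apply: ex_derive; apply: dD.
have val (K : finType) (u c d : K -> R) :
    \sum_i u i * (d i - c i) * (ln (d i) - ln (c i)) =
    log_interp u c d 1 - log_interp u c d 0.
  rewrite /log_interp -sumrB; apply: eq_bigr => i _.
  by rewrite subrr mul0r addr0 mul1r subr0 mul0r add0r mul1r; ring.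
move: inc; rewrite !val /D !fctE; lra.
Qed.

Lemma within_itv_continuous (f : R -> R) (a b : R) :
  (forall x, derivable f x 1) -> {within `[a, b], continuous f}.
Proof. by move=> df; apply: derivable_within_continuous => x _. Qed.

Lemma continuous_integrable01 (f : R -> R) : (forall x, derivable f x 1) ->
  (@lebesgue_measure R).-integrable `[0, 1] (EFin \o f).
Proof.
move=> df; apply: continuous_compact_integrable; first exact: segment_compact.
exact: within_itv_continuous.
Qed.

Lemma Rintegral01_sum I (r : seq I) (c : I -> R) (f : I -> R -> R) :
  (forall i x, derivable (f i) x 1) ->
  \int[lebesgue_measure]_(s in `[0, 1]) (\sum_(i <- r) c i * f i s) =
  \sum_(i <- r) c i * \int[lebesgue_measure]_(s in `[0, 1]) f i s :> R.
Proof.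
move=> df.
have mI : measurable (`[0, 1]%classic : set R) by exact: measurable_itv.
have dr s : forall x, derivable (fun t => \sum_(i <- s) c i * f i t) x 1.
  move=> x; apply: (@ex_derive _ _ _ _ _ _ (\sum_(i <- s) c i * 'D_1 (f i) x)).
  apply: is_derive_bigsum => i.
  exact: (is_deriveZ (c i) (derivableP (df i x))).
elim: r => [|i r IH].
  rewrite big_nil; under eq_Rintegral do rewrite big_nil.
  by rewrite Rintegral_cst // mul0r.
rewrite big_cons -IH -RintegralZl //; last exact: continuous_integrable01.
under eq_Rintegral do rewrite big_cons.
rewrite RintegralD //; last exact: continuous_integrable01.
apply: (@continuous_integrable01 (fun t => c i * f i t)) => x.
apply: ex_derive; exact: (is_deriveZ (c i) (derivableP (df i x))).
Qed.

(** The kernel of the operation # in eigenbases of its two arguments. *)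
Definition logmean (a b : R) : R :=
  \int[lebesgue_measure]_(s in `[0, 1]) (a `^ (1 - s) * b `^ s).

Lemma geom_interpE (a b s : R) : 0 < a -> 0 < b ->
  a `^ (1 - s) * b `^ s = expR (ln a + s * (ln b - ln a)).
Proof.
move=> a0 b0; rewrite /powR !gt_eqF // -expRD; congr expR; ring.
Qed.

Lemma is_derive_exp_affine (k l s : R) :
  is_derive s 1 (fun s => expR (k + s * l)) (l * expR (k + s * l)).
Proof.
have dl : is_derive s 1 (fun s => k + s * l) l.
  rewrite (_ : (fun s => _) = cst k + l \*: (id : R -> R)).
    by apply: is_derive_eq; rewrite add0r -[RHS]mulr1.
  by apply/funext => t; rewrite -[RHS]/(k + l * t) mulrC.
apply: is_derive_eq
  (@is_derive1_comp R _ (fun s => k + s * l) s _ _ (is_derive_expR _) dl) _.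
by rewrite mulrC.
Qed.

Lemma derivable_geom_interp (a b x : R) : 0 < a -> 0 < b ->
  derivable (fun s : R => a `^ (1 - s) * b `^ s) x 1.
Proof.
move=> a0 b0; rewrite (_ : (fun s => _) = fun s : R => expR (ln a + s * (ln b - ln a))).
  by apply: ex_derive; apply: is_derive_exp_affine.
by apply/funext => s; rewrite geom_interpE.
Qed.

(** The integrand is the exponential of an affine function of s, with slope
    ln b - ln a. *)
Lemma logmean_ln (a b : R) : 0 < a -> 0 < b ->
  logmean a b * (ln b - ln a) = b - a.
Proof.
move=> a0 b0; set l := ln b - ln a.
have -> : logmean a b = \int[lebesgue_measure]_(s in `[0, 1]) expR (ln a + s * l).
  by apply: eq_Rintegral => s _; rewrite geom_interpE.
have dF (x : R) : derivable (fun s : R => expR (ln a + s * l)) x 1.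
  by apply: ex_derive; apply: is_derive_exp_affine.
rewrite mulrC -RintegralZl //; last exact: (continuous_integrable01 dF).
rewrite /Rintegral (@continuous_FTC2 R _ (fun s : R => expR (ln a + s * l))) //.
- rewrite /= mul0r addr0 mul1r /l [ln a + _]addrC subrK !lnK // posrE.
- apply: within_itv_continuous => x.
  apply: ex_derive; apply: (is_deriveZ l (is_derive_exp_affine (ln a) l x)).
- have cF : continuous (fun s : R => expR (ln a + s * l)).
    by move=> x; apply: differentiable_continuous; apply/derivable1_diffP.
  split.
  + by move=> x _.
  + by apply: cvg_at_right_filter; apply: cF.
  + by apply: cvg_at_left_filter; apply: cF.
- move=> x _; rewrite derive1E; have d := is_derive_exp_affine (ln a) l x.
  by rewrite derive_val.
Qed.

Lemma logmean_gt0 (a b : R) : 0 < a -> 0 < b -> 0 < logmean a b.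
Proof.
move=> a0 b0; have [eab|nab] := eqVneq a b.
  rewrite /logmean -eab.
  have -> : \int[lebesgue_measure]_(s in `[0, 1]) (a `^ (1 - s) * a `^ s) =
      \int[lebesgue_measure]_(s in `[0, 1]) (cst a s) :> R.
    apply: eq_Rintegral => s _; rewrite geom_interpE // subrr mulr0 addr0; exact: lnK.
  rewrite Rintegral_cst //= lebesgue_measure_itv /= lte_fin ltr01.
  by rewrite -EFinB /= subr0 mulr1.
have := logmean_ln a0 b0; have := logmean_ln b0 a0.
have [lt|lt|/eqP] := ltgtP a b; last by rewrite (negPf nab).
- have : 0 < ln b - ln a by rewrite subr_gt0 ltr_ln // posrE.
  by move=> l0 _ e; rewrite -(pmulr_lgt0 _ l0) e subr_gt0.
- have l0 : ln b - ln a < 0 by rewrite subr_lt0 ltr_ln // posrE.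
  by move=> _ e; rewrite -(nmulr_llt0 _ l0) e subr_lt0.
Qed.

(** The best constant on [0, 1] is k (k - 1) / 2; only its independence of x and y
    matters. *)
Lemma pow_taylor_le (x y : R) (k : nat) : 0 <= x <= 1 -> 0 <= y <= 1 ->
  `|y ^+ k - x ^+ k - (y - x) * (x ^+ k.-1 *+ k)| <= (k ^ 2)%:R * (y - x) ^+ 2.
Proof.
move=> /andP[x0 x1] /andP[y0 y1].
have lip m : `|y ^+ m - x ^+ m| <= m%:R * `|y - x|.
  elim: m => [|m IH]; first by rewrite subrr normr0 mul0r.
  have -> : y ^+ m.+1 - x ^+ m.+1 = y * (y ^+ m - x ^+ m) + x ^+ m * (y - x).
    rewrite !exprS; ring.
  apply: le_trans (ler_normD _ _) _; rewrite !normrM -natr1 mulrDl mul1r lerD //.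
    apply: le_trans IH; rewrite ler_piMl // ger0_norm //.
  by rewrite ler_piMl // ger0_norm ?exprn_ge0 // exprn_ile1.
elim: k => [|k IH]; first by rewrite !expr0 subrr mulr0n mulr0 subr0 normr0 mul0r.
have -> : y ^+ k.+1 - x ^+ k.+1 - (y - x) * (x ^+ k.+1.-1 *+ k.+1) =
  x * (y ^+ k - x ^+ k - (y - x) * (x ^+ k.-1 *+ k)) + (y - x) * (y ^+ k - x ^+ k).
  case: k {IH} => [|k]; first by rewrite /= !expr1 !expr0; ring.
  rewrite /= [x ^+ k.+1 *+ _]mulrS !exprS -[(x * _) *+ _]mulrnAr.
  by move: (x ^+ k *+ k.+1) (x ^+ k) (y ^+ k) => p u v; ring.
apply: le_trans (ler_normD _ _) _; rewrite !normrM.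
have h1 : `|x| * `|y ^+ k - x ^+ k - (y - x) * (x ^+ k.-1 *+ k)|
    <= (k ^ 2)%:R * (y - x) ^+ 2.
  by apply: le_trans IH; rewrite ler_piMl // ger0_norm.
have h2 : `|y - x| * `|y ^+ k - x ^+ k| <= k%:R * (y - x) ^+ 2.
  rewrite -(real_normK (num_real (y - x))) expr2 mulrCA ler_wpM2l //.
have h3 : 0 <= (y - x) ^+ 2 by apply: sqr_ge0.
have h4 : ((k.+1 ^ 2)%N%:R : R) = (k ^ 2)%N%:R + k%:R + k%:R + 1.
  by rewrite !natrX -[k.+1%:R]natr1; ring.
have h5 : (0 : R) <= k%:R by [].
rewrite h4; nra.
Qed.

End RealAnalysis.

(** * From entropy growth to a bound on the length *)

Section LengthEstimate.
Variable R : realType.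

(** Discrete form of (int g)^2 = 2 int g(r) (int_0^r g) <= 2 int r g(r)^2: adding
    the term m increases the square by g m (2 sum_{i < m} g i + g m), and each
    g i is at most g m. *)
Lemma sqr_sum_nondecreasing_le (g : nat -> R) (m : nat) :
  {homo g : i j / (i <= j)%N >-> i <= j} -> (forall i, 0 <= g i) ->
  (\sum_(i < m) g i) ^+ 2 <= \sum_(i < m) (2 * i%:R + 1) * g i ^+ 2.
Proof.
move=> mg g0; elim: m => [|m IH]; first by rewrite !big_ord0 expr0n.
rewrite !big_ord_recr /=; set S := \sum_(i < m) g i in IH *.
have Sm : S <= m%:R * g m.
  have -> : m%:R * g m = \sum_(i < m) g m by rewrite sumr_const card_ord mulr_natl.
  by apply: ler_sum => i _; apply: mg; apply: ltnW (ltn_ord i).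
have := g0 m; rewrite sqrrD => gm0; rewrite -addrA lerD //.
have := ler_wpM2r gm0 Sm; rewrite expr2 mulr2n; lra.
Qed.

Lemma measurable_EFin_nonincreasing (G : R -> R) (D : set R) :
  {homo G : x y /~ x <= y} -> measurable_fun D (fun u => (G u)%:E).
Proof.
move=> mG; apply: measurable_funTS.
apply/measurable_realfun.measurable_EFinP.
apply: measurable_realfun.nonincreasing_measurable => // x y; exact: mG.
Qed.

Lemma integral_itv_nonincreasing_le (G : R -> R) (a b : R) : a <= b ->
  {homo G : x y /~ x <= y} -> (forall x, 0 <= G x) ->
  (\int[lebesgue_measure]_(u in `]a, b]) (G u)%:E <= ((b - a) * G a)%:E)%E.
Proof.
move=> ab mG G0.
have mD : measurable (`]a, b]%classic : set R) by exact: measurable_itv.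
apply: (@le_trans _ _ (\int[lebesgue_measure]_(u in `]a, b]) (cst (G a)%:E u))%E).
  apply: ge0_le_integral => //.
  - by move=> x _; rewrite lee_fin.
  - exact: measurable_EFin_nonincreasing.
  - by move=> x /=; rewrite in_itv /= lee_fin => /andP[/ltW ax _]; apply: mG.
rewrite integral_cst; last exact: mD.
rewrite /= lebesgue_measure_itv /= lte_fin.
case: ltP => [_|ba]; first by rewrite -EFinB -EFinM mulrC.
by rewrite mule0 lee_fin mulr_ge0 // subr_ge0.
Qed.

Lemma integral_riemann_le (G : R -> R) (d : R) (m : nat) : 0 <= d ->
  {homo G : x y /~ x <= y} -> (forall x, 0 <= G x) ->
  (\int[lebesgue_measure]_(u in `]0%R, (m%:R * d)%R]) (G u)%:E
    <= (d * \sum_(j < m) G (j%:R * d))%:E)%E.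
Proof.
move=> d0 mG G0; elim: m => [|m IH].
  by rewrite mul0r big_ord0 mulr0 set_itvoc0 integral_set0.
have mI (x y : R) : measurable (`]x, y]%classic : set R) by exact: measurable_itv.
have md : m%:R * d <= m.+1%:R * d by rewrite ler_wpM2r // ler_nat.
have -> : `]0%R, m.+1%:R * d]%classic =
    `]0%R, m%:R * d]%classic `|` `]m%:R * d, m.+1%:R * d]%classic :> set R.
  by rewrite -itv_bndbnd_setU // bnd_simp ?mulr_ge0.
rewrite ge0_integral_setU //.
- rewrite big_ord_recr /= mulrDr EFinD leeD //.
  apply: le_trans (integral_itv_nonincreasing_le md mG G0) _.
  by rewrite -mulrBl -natr1 addrAC subrr add0r mul1r.
- exact: measurable_EFin_nonincreasing.
- by move=> x _; rewrite lee_fin.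
- rewrite disj_set2E; apply/eqP; rewrite -subset0 => x /= [].
  by rewrite !in_itv /= => /andP[_ /le_lt_trans xm] /andP[/xm]; rewrite ltxx.
Qed.

(** If [s] grows at least at rate r (g r)^2 with [g] nondecreasing, then
    (int g)^2 = 2 int g(r) (int_0^r g) <= 2 int r (g r)^2 <= 2 (s 1 - s 0);
    carried out on Riemann sums, where neither [g] needs to be continuous nor
    [s] differentiable. *)
Lemma length_le_sqrt (g s : R -> R) (K : R) : 0 <= K ->
  {homo g : x y / x <= y} -> (forall x, 0 <= g x) ->
  (forall r, 0 <= r <= 1 -> 0 <= s r) ->
  (forall r r', 0 < r -> r <= r' -> r' <= 1 ->
     (r' - r) * (r * g r ^+ 2) - K * (r' - r) ^+ 2 <= s r' - s r) ->
  (\int[lebesgue_measure]_(u in `]0%R, 1%R[) (g (1 - u))%:E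
     <= (Num.sqrt (2 * s 1))%:E)%E.
Proof.
move=> K0 mg g0 s0 sg; pose G (u : R) := g (1 - u).
have mG : {homo G : x y /~ x <= y} by move=> x y xy; apply: mg; rewrite lerB.
have G0 x : 0 <= G x by apply: g0.
set I := (\int[_]_(_ in _) _)%E.
pose x (m : nat) : R := m.+1%:R^-1 * \sum_(j < m.+1) g (j.+1%:R / m.+1%:R).
have Ix m : (I <= (x m)%:E)%E.
  have dm : (0 : R) <= m.+1%:R^-1 by rewrite invr_ge0.
  have := integral_riemann_le m.+1 dm mG G0.
  rewrite mulfV ?pnatr_eq0 // => h.
  apply: (@le_trans _ _ (\int[lebesgue_measure]_(u in `]0%R, 1%R]) (G u)%:E)%E).
    apply: ge0_subset_integral => //.
    - exact: measurable_EFin_nonincreasing.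
    - by move=> u _; rewrite lee_fin.
    - by move=> u /=; rewrite !in_itv /= => /andP[-> /ltW].
  apply: le_trans h _; rewrite lee_fin /x (reindex_inj rev_ord_inj) /=.
  rewrite le_eqVlt; apply/orP; left; apply/eqP; congr (_ * _).
  apply: eq_bigr => j _; rewrite /G; congr g.
  rewrite natrB; last exact: ltn_ord.
  by rewrite mulrBl mulfV ?pnatr_eq0 //; ring.
have x2 m : x m ^+ 2 <= 2 * s 1 + 2 * (K + g 1 ^+ 2) / m.+1%:R.
  set d : R := m.+1%:R^-1; have d0 : 0 < d by rewrite invr_gt0 ltr0n.
  have dM : m.+1%:R * d = 1 by rewrite /d mulfV ?pnatr_eq0.
  pose h (j : nat) := g (j.+1%:R * d).
  have hm : {homo h : i j / (i <= j)%N >-> i <= j}.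
    by move=> i j ij; apply: mg; rewrite ler_pM2r // ler_nat.
  (* Telescoping the growth hypothesis along the grid gives the Riemann sum of
     r (g r)^2; the grid is shifted by one step, which leaves out its last point. *)
  have tail k : (k <= m)%N -> d * \sum_(i < k) i.+1%:R * d * h i ^+ 2 <=
      s (k.+1%:R * d) + K * d ^+ 2 * k%:R.
    elim: k => [_|k IH km].
      rewrite big_ord0 !mulr0 addr0; apply: s0; rewrite mul1r ltW //=.
      by rewrite /d invf_le1 ?ltr0n // ler1n.
    rewrite big_ord_recr /= mulrDr.
    have := sg (k.+1%:R * d) (k.+2%:R * d).
    rewrite mulr_gt0 // => /(_ isT).
    rewrite ler_pM2r // ler_nat leqnSn => /(_ isT).
    have -> : k.+2%:R * d <= 1 by rewrite -[leRHS]dM ler_pM2r // ler_nat ltnS.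
    move=> /(_ isT); rewrite -mulrBl -[k.+2%:R]natr1 addrAC subrr add0r mul1r.
    rewrite [_ + 1]natr1 -/(h k) => E1; have E2 := IH (ltnW km).
    have -> : K * d ^+ 2 * k.+1%:R = K * d ^+ 2 * k%:R + K * d ^+ 2.
      by rewrite -[k.+1%:R]natr1 mulrDr mulr1.
    lra.
  have := sqr_sum_nondecreasing_le m.+1 hm (fun i => g0 _).
  have := tail m (leqnn m); rewrite dM => t q.
  have xE : x m = d * \sum_(i < m.+1) h i by [].
  rewrite xE exprMn.
  have b1 : d ^+ 2 * (\sum_(i < m.+1) h i) ^+ 2 <=
      2 * (d * \sum_(i < m.+1) i.+1%:R * d * h i ^+ 2).
    apply: le_trans (ler_wpM2l (ltW (exprn_gt0 2 d0)) q) _.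
    rewrite !mulr_sumr; apply: ler_sum => i _; rewrite -natr1.
    have := sqr_ge0 (h i); have : 0 < d ^+ 2 by rewrite exprn_gt0.
    rewrite expr2; nra.
  apply: le_trans b1 _; rewrite big_ord_recr /= dM mul1r.
  have hM : h m = g 1 by rewrite /h dM.
  rewrite hM.
  have dm1 : d * m%:R <= 1.
    by rewrite mulrC -[leRHS]dM ler_pM2r // ler_nat.
  have : K * d * (d * m%:R) <= K * d by rewrite ler_piMr // mulr_ge0 // ltW.
  move: (\sum_(i < m) _) t => A; nra.
have Ifin : I \is a fin_num.
  rewrite ge0_fin_numE; first exact: le_lt_trans (Ix 0%N) (ltry _).
  by apply: integral_ge0 => u _; rewrite lee_fin.
have I0 : 0 <= fine I.
  by apply: fine_ge0; apply: integral_ge0 => u _; rewrite lee_fin.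
rewrite -(fineK Ifin) lee_fin.
rewrite -[leLHS](ger0_norm I0) -sqrtr_sqr ler_wsqrtr //.
rewrite leNgt; apply/negP => lt.
pose e := fine I ^+ 2 - 2 * s 1; have e0 : 0 < e by rewrite subr_gt0.
pose c := 2 * (K + g 1 ^+ 2).
have c0 : 0 <= c by rewrite mulr_ge0 // addr_ge0 // sqr_ge0.
have := archi_boundP (divr_ge0 c0 (ltW e0)); set k := Num.bound _ => kP.
have := x2 k; rewrite -/c => h.
have Ik : fine I <= x k by rewrite -lee_fin fineK.
have : fine I ^+ 2 <= x k ^+ 2 by rewrite ler_sqr // nnegrE // (le_trans I0).
have : c / k.+1%:R < e.
  rewrite ltr_pdivrMr ?ltr0n // mulrC -ltr_pdivrMr //.
  by apply: lt_le_trans kP _; rewrite ler_nat.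
rewrite /e => h1 h2; move: h h1 h2; set q := c / _; lra.
Qed.

End LengthEstimate.

(** * The inverse quadratic form as a supremum *)

Section Variational.
Variables (R : realType) (N : nat).
Local Notation C := R[i].
Local Notation op := 'M[C]_N.
Implicit Types (A B X Y S T V : op).

Lemma spec_mul_rotated (S : op) b (Y T : op) : S \is unitarymx -> T \is unitarymx ->
  S *m (spec S b *m Y) *m T^t* = rdiag b *m (S *m Y *m T^t*).
Proof. by move=> uS uT; rewrite /spec !mulmxA (unitary_mulV uS) mul1mx. Qed.

Lemma mul_spec_rotated (S : op) b (Y T : op) : S \is unitarymx -> T \is unitarymx ->
  T *m (Y *m spec S b) *m S^t* = (T *m Y *m S^t*) *m rdiag b.
Proof.
move=> uS uT; rewrite /spec !mulmxA -[_ *m S *m S^t*]mulmxA (unitary_mulV uS).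
by rewrite mulmx1.
Qed.

Lemma hsdot_spec_l S b (T : op) Y : S \is unitarymx -> T \is unitarymx ->
  hsdot Y (spec S b *m Y) = \sum_i \sum_j b i * sqmod ((S *m Y *m T^t*) i j).
Proof.
move=> uS uT; rewrite -(hsdot_unitary _ _ uS uT) spec_mul_rotated // hsdotE.
apply: eq_bigr => i _; apply: eq_bigr => j _.
rewrite rdiag_mulE ReZ ImZ /sqmod; ring.
Qed.

Lemma hsdot_spec_r S b (T : op) Y : S \is unitarymx -> T \is unitarymx ->
  hsdot Y (Y *m spec S b) = \sum_i \sum_j b j * sqmod ((T *m Y *m S^t*) i j).
Proof.
move=> uS uT; rewrite -(hsdot_unitary _ _ uT uS) mul_spec_rotated // hsdotE.
apply: eq_bigr => i _; apply: eq_bigr => j _.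
rewrite mul_rdiagE ReZ ImZ /sqmod; ring.
Qed.

(** Its supremum over [Y] is the value at [X] of the inverse of the quadratic
    form of s L_A + (1 - s) R_B; integrated over s this inverse becomes the
    inverse of the logarithmic mean of L_A and R_B. *)
Definition legendre (s : R) A B X Y : R :=
  2 * hsdot X Y - s * hsdot Y (A *m Y) - (1 - s) * hsdot Y (Y *m B).

(** The supremum of [legendre], computed in eigenbases of the two operators. *)
Definition invform (s : R) (S : op) a (T : op) b (X : op) : R :=
  \sum_i \sum_j sqmod ((S *m X *m T^t*) i j) / (s * a i + (1 - s) * b j).

Lemma legendre_rotated s S a T b X Y : S \is unitarymx -> T \is unitarymx ->
  legendre s (spec S a) (spec T b) X Y =
  \sum_i \sum_j
    let x := (S *m X *m T^t*) i j in let y := (S *m Y *m T^t*) i j in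
    (2 * (complex.Re x * complex.Re y + complex.Im x * complex.Im y)
     - (s * a i + (1 - s) * b j) * sqmod y).
Proof.
move=> uS uT; rewrite /legendre (hsdot_spec_l _ _ uS uT) (hsdot_spec_r _ _ uT uS).
rewrite -(hsdot_unitary X Y uS uT) hsdotE !mulr_sumr -!sumrB.
apply: eq_bigr => i _; rewrite !mulr_sumr -!sumrB; apply: eq_bigr => j _ /=.
ring.
Qed.

Lemma legendre_le s S a T b X Y : 0 <= s <= 1 ->
  S \is unitarymx -> T \is unitarymx -> (forall i, 0 < a i) -> (forall i, 0 < b i) ->
  legendre s (spec S a) (spec T b) X Y <= invform s S a T b X.
Proof.
move=> s01 uS uT a0 b0; rewrite legendre_rotated //.
apply: ler_sum => i _; apply: ler_sum => j _.
case: ((_ *m X *m _) i j) => x1 x2; case: ((_ *m Y *m _) i j) => y1 y2 /=.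
have := interp_gt0 s01 (a0 i) (b0 j); set c := _ + _ => c0.
rewrite ler_pdivlMr // /sqmod /=.
have := sqr_ge0 (x1 - c * y1); have := sqr_ge0 (x2 - c * y2).
rewrite !expr2; nra.
Qed.

(** The maximiser divides the rotated matrix of [X] entrywise by the
    eigenvalues s a_i + (1 - s) b_j of the quadratic form. *)
Lemma legendre_max s S a T b X : 0 <= s <= 1 ->
  S \is unitarymx -> T \is unitarymx -> (forall i, 0 < a i) -> (forall i, 0 < b i) ->
  exists Y, legendre s (spec S a) (spec T b) X Y = invform s S a T b X.
Proof.
move=> s01 uS uT a0 b0.
pose Z : op := \matrix_(i, j)
  (((s * a i + (1 - s) * b j)^-1)%:C * (S *m X *m T^t*) i j).
exists (S^t* *m Z *m T); rewrite legendre_rotated //.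
have -> : S *m (S^t* *m Z *m T) *m T^t* = Z.
  rewrite !mulmxA (unitary_mulV uS) mul1mx -mulmxA (unitary_mulV uT).
  by rewrite mulmx1.
apply: eq_bigr => i _; apply: eq_bigr => j _.
rewrite [Z i j]mxE /= ReZ ImZ /sqmod ReZ ImZ.
case: ((_ *m X *m _) i j) => x1 x2 /=.
have := interp_gt0 s01 (a0 i) (b0 j); set c := _ + _ => c0.
by field; rewrite gt_eqF.
Qed.

(** Working with upper bounds instead of the supremum itself lets convexity be
    iterated without diagonalising the intermediate operators. *)
Definition legendre_bound c s A B X := forall Y, legendre s A B X Y <= c.

Lemma legendre_conj s V A B X Y : V \is unitarymx ->
  legendre s (V *m A *m V^t*) (V *m B *m V^t*) (V *m X *m V^t*) Y =
  legendre s A B X (V^t* *m Y *m V).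
Proof.
move=> uV; set Z := V^t* *m Y *m V.
have -> : Y = V *m Z *m V^t*.
  rewrite /Z !mulmxA (unitary_mulV uV) mul1mx -mulmxA (unitary_mulV uV).
  by rewrite mulmx1.
have cj M M' : V *m M *m V^t* *m (V *m M' *m V^t*) = V *m (M *m M') *m V^t*.
  by rewrite !mulmxA -[_ *m V^t* *m V]mulmxA (unitary_mulVl uV) mulmx1.
by rewrite /legendre !cj !hsdot_unitary.
Qed.

Definition mixc (q : R) (V A : op) : op :=
  ((1 + q) / 2)%:C *: A + ((1 - q) / 2)%:C *: (V *m A *m V^t*).

(** For fixed [Y] the functional is linear in (A, B, X) jointly, and
    conjugating (A, B, X) amounts to conjugating [Y] back: a supremum of such
    functionals can only decrease under averaging. *)
Lemma legendre_bound_mixc c s q V A B X : -1 <= q <= 1 -> V \is unitarymx ->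
  legendre_bound c s A B X ->
  legendre_bound c s (mixc q V A) (mixc q V B) (mixc q V X).
Proof.
move=> /andP[q0 q1] uV bnd Y.
have h1 := bnd Y; have h2 := bnd (V^t* *m Y *m V).
rewrite -(legendre_conj s A B X Y uV) in h2.
have -> : legendre s (mixc q V A) (mixc q V B) (mixc q V X) Y =
  (1 + q) / 2 * legendre s A B X Y + (1 - q) / 2 *
   legendre s (V *m A *m V^t*) (V *m B *m V^t*) (V *m X *m V^t*) Y.
  rewrite /legendre /mixc !mulmxDl !mulmxDr -!scalemxAl -!scalemxAr.
  rewrite hsdotDl !hsdotDr !hsdotZr !hsdotZl; ring.
nra.
Qed.

End Variational.

(** * Relative entropy *)

Section RelativeEntropy.
Variables (R : realType) (N : nat).
Local Notation C := R[i].
Local Notation op := 'M[C]_N.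
Implicit Types (S T X Z : op) (u v b d : 'I_N -> R).

(** The squared entries of T S^* are the overlaps of the two eigenbases. *)
Lemma hsdot_spec_spec S u T v : S \is unitarymx -> T \is unitarymx ->
  hsdot (spec S u) (spec T v) =
  \sum_i \sum_j u j * v i * sqmod ((T *m S^t*) i j).
Proof.
move=> uS uT; rewrite -(hsdot_unitary _ _ uT uS) hsdotE.
have -> : T *m spec S u *m S^t* = (T *m S^t*) *m rdiag u.
  by rewrite /spec !mulmxA -[_ *m S *m S^t*]mulmxA (unitary_mulV uS) mulmx1.
have -> : T *m spec T v *m S^t* = rdiag v *m (T *m S^t*).
  by rewrite /spec !mulmxA (unitary_mulV uT) mul1mx.
apply: eq_bigr => i _; apply: eq_bigr => j _.
rewrite rdiag_mulE mul_rdiagE !ReZ !ImZ /sqmod; ring.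
Qed.

Lemma xlnx_ge (x y : R) : 0 < x -> 0 < y ->
  x * ln y + x <= x * ln x + y.
Proof.
move=> x0 y0; have := expR_ge1Dx (ln y - ln x).
rewrite expRD expRN !lnK ?posrE // => h.
have := ler_wpM2l (ltW x0) h; rewrite [y / x]mulrC mulrA mulfV ?gt_eqF // mul1r.
lra.
Qed.

Lemma hsdot_spec_one S X : S \is unitarymx ->
  hsdot (spec S (fun=> 1)) X = complex.Re (\tr X).
Proof.
move=> uS; rewrite /hsdot spec_adj /spec (_ : rdiag _ = 1%:M).
  by rewrite mulmx1 unitary_mulVl // mul1mx.
by apply/matrixP=> i j; rewrite !mxE.
Qed.

(** Klein's inequality: relative entropy is nonnegative. Expanded over the
    overlaps of the two eigenbases it reduces termwise to [xlnx_ge]. *)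
Lemma klein S b T d : S \is unitarymx -> T \is unitarymx ->
  (forall i, 0 < b i) -> (forall i, 0 < d i) ->
  complex.Re (\tr (spec S b)) = complex.Re (\tr (spec T d)) ->
  hsdot (spec S (fun i => ln (b i))) (spec T d) <=
  hsdot (spec T (fun i => ln (d i))) (spec T d).
Proof.
move=> uS uT b0 d0.
rewrite -(hsdot_spec_one (spec S b) uT) -(hsdot_spec_one (spec T d) uS).
have -> : hsdot (spec T (fun i => ln (d i))) (spec T d) =
    hsdot (spec S (fun=> 1)) (spec T (fun i => ln (d i) * d i)).
  by rewrite (hsdot_spec_one _ uS) /hsdot spec_adj spec_mul.
have E u v := hsdot_spec_spec u v uS uT.
move=> etr; have {}etr := etrans (esym (E b (fun=> 1)))
  (etrans (hsdotC _ _) (etrans etr (E (fun=> 1) d))).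
rewrite [leLHS]E [leRHS]E.
pose s i j := sqmod ((T *m S^t*) i j).
have : \sum_i \sum_j (ln (b j) * d i * s i j + 1 * d i * s i j) <=
    \sum_i \sum_j (1 * (ln (d i) * d i) * s i j + b j * 1 * s i j).
  apply: ler_sum => i _; apply: ler_sum => j _.
  have := xlnx_ge (d0 i) (b0 j).
  have : 0 <= s i j by apply: sqmod_ge0.
  move: (s i j) => t; nra.
under eq_bigr do rewrite big_split /=.
under [leRHS]eq_bigr do rewrite big_split /=.
by rewrite !big_split /= etr lerD2r.
Qed.

Lemma hsdot_spec_bound S u (L : R) Z : S \is unitarymx ->
  (forall i, `|u i| <= L) ->
  `|hsdot (spec S u) Z| <= N%:R * (L * (1 + hsdot Z Z)).
Proof.
move=> uS uL; rewrite -(hsdot_unitary _ _ uS uS).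
have -> : S *m spec S u *m S^t* = rdiag u.
  by rewrite /spec !mulmxA (unitary_mulV uS) mul1mx -mulmxA (unitary_mulV uS) mulmx1.
set W := S *m Z *m S^t*; have eW : hsdot W W = hsdot Z Z by apply: hsdot_unitary.
have -> : hsdot (rdiag u) W = \sum_i u i * complex.Re (W i i).
  rewrite hsdotE; apply: eq_bigr => i _; rewrite (bigD1 i) //= big1 => [|j ji].
    by rewrite !mxE eqxx /= mul0r !addr0.
  by rewrite !mxE eq_sym (negPf ji) /= !mul0r addr0.
rewrite -eW; apply: le_trans (ler_norm_sum _ _ _) _.
have -> : N%:R * (L * (1 + hsdot W W)) = \sum_(i < N) L * (1 + hsdot W W).
  by rewrite sumr_const card_ord mulr_natl.
apply: ler_sum => i _; rewrite normrM ler_pM //.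
apply: (@le_trans _ _ (1 + complex.Re (W i i) ^+ 2)).
  case: (ger0P (complex.Re (W i i))); rewrite expr2; nra.
rewrite lerD2l hsdotxx (bigD1 i) //= (bigD1 i) //= /sqmod -!addrA ler_wpDr //.
rewrite !addr_ge0 ?sqr_ge0 // sumr_ge0 // => k _; last apply: sumr_ge0 => l _.
all: exact: sqmod_ge0.
Qed.

End RelativeEntropy.

(** * Tensor products of Pauli matrices *)

Section Tensor.
Variables (R : realType) (n : nat).
Local Notation C := R[i].
Local Notation op := 'M[C]_(hdim n).

Lemma sum_hdim (F : {ffun 'I_n -> 'I_2} -> C) :
  \sum_(a < hdim n) F (enum_val a) = \sum_f F f.
Proof.
symmetry; apply: (reindex (fun a : 'I_(hdim n) => enum_val a)).
exact/onW_bij/enum_val_bij.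
Qed.

Lemma tensorM (A B : 'I_n -> 'M[C]_2) :
  tensor A *m tensor B = tensor (fun k => A k *m B k).
Proof.
apply/matrixP=> a b; rewrite !mxE; under [RHS]eq_bigr do rewrite mxE.
rewrite bigA_distr_bigA /= -sum_hdim; apply: eq_bigr => c _.
by rewrite !mxE -big_split.
Qed.

Lemma tensor1 : tensor (fun=> 1%:M) = 1%:M :> op.
Proof.
apply/matrixP=> a b; rewrite !mxE; have [->|ab] := eqVneq a b.
  by rewrite big1 // => k _; rewrite mxE eqxx.
have /eqP/ffunP nab : enum_val a != enum_val b by rewrite (inj_eq enum_val_inj).
apply/eqP; rewrite prodf_seq_eq0; apply/hasP.
have [k /eqP kab] : exists k, enum_val a k != enum_val b k.
  case: (boolP [exists k, enum_val a k != enum_val b k]) => [/existsP //|/existsPn h].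
  by case: nab => k; apply/eqP; have := h k; rewrite negbK.
exists k; first exact: mem_index_enum.
by rewrite /= mxE (introF eqP kab).
Qed.

Lemma tensor_adj (A : 'I_n -> 'M[C]_2) :
  (tensor A)^t* = tensor (fun k => (A k)^t*).
Proof.
apply/matrixP=> a b; rewrite !mxE rmorph_prod.
by apply: eq_bigr => k _; rewrite !mxE.
Qed.

Lemma eq_tensor (A B : 'I_n -> 'M[C]_2) : A =1 B -> tensor A = tensor B.
Proof.
by move=> AB; apply/matrixP=> a b; rewrite !mxE; under eq_bigr do rewrite AB.
Qed.

Lemma tensorN (i : 'I_n) (A B : 'I_n -> 'M[C]_2) :
  A i = - B i -> (forall k, k != i -> A k = B k) -> tensor A = - tensor B.
Proof.
move=> Ai AB; apply/matrixP=> a b; rewrite !mxE (bigD1 i) // [in RHS](bigD1 i) //=.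
by rewrite Ai mxE mulNr; under eq_bigr => k ki do rewrite AB //.
Qed.

Local Notation pQ := (pauliQ R).
Local Notation pU := (pauliU R).

Lemma pauliQ_sq : pQ *m pQ = 1%:M.
Proof.
apply/matrixP=> i j; rewrite !mxE !big_ord_recl big_ord0 !mxE.
by case: i => [[|[|//]] hi]; case: j => [[|[|//]] hj] //=;
  rewrite ?(mulr0, mulr1, addr0, add0r).
Qed.

Lemma pauliU_sq : pU *m pU = 1%:M.
Proof.
apply/matrixP=> i j; rewrite !mxE !big_ord_recl big_ord0 !mxE.
by case: i => [[|[|//]] hi]; case: j => [[|[|//]] hj] //=;
  rewrite ?(expr0, expr1, mulr0, mulr1, mul0r, mulrNN, addr0, add0r).
Qed.

Lemma pauliUQ : pU *m pQ = - (pQ *m pU).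
Proof.
apply/matrixP=> i j; rewrite !mxE !big_ord_recl !big_ord0 !mxE.
by case: i => [[|[|//]] hi]; case: j => [[|[|//]] hj] //=;
  rewrite ?(expr0, expr1, mulr0, mulr1, mul0r, mul1r, mulrN, mulNr, opprK, oppr0, addr0, add0r).
Qed.

Lemma pauliQ_adj : pQ^t* = pQ.
Proof. by apply/matrixP=> i j; rewrite !mxE eq_sym; case: eqP; rewrite ?rmorph0 ?rmorph1. Qed.

Lemma pauliU_adj : pU^t* = pU.
Proof.
apply/matrixP=> i j; rewrite !mxE eq_sym.
by case: eqP => [->|_]; rewrite ?rmorph0 // rmorphXn rmorphN1.
Qed.

(** The grading operator: it anticommutes with every generator, so conjugation
    by it extends [Gamma] to an automorphism of the full matrix algebra. *)
Definition parity : op := tensor (fun=> pU).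

Lemma parity_sq : parity *m parity = 1%:M.
Proof. by rewrite tensorM (eq_tensor (fun=> pauliU_sq)) tensor1. Qed.

Lemma parity_adj : parity^t* = parity.
Proof. by rewrite tensor_adj; apply: eq_tensor => k; apply: pauliU_adj. Qed.

Lemma Q_sq (i : 'I_n) : Q R i *m Q R i = 1%:M.
Proof.
rewrite tensorM -tensor1; apply: eq_tensor => k.
case: ifP => _; first exact: pauliU_sq.
by case: ifP => _; [exact: pauliQ_sq | rewrite mulmx1].
Qed.

Lemma Q_adj (i : 'I_n) : (Q R i)^t* = Q R i.
Proof.
rewrite tensor_adj; apply: eq_tensor => k.
case: ifP => _; first exact: pauliU_adj.
by case: ifP => _; [exact: pauliQ_adj | rewrite adjmx1].
Qed.

Lemma parityQ (i : 'I_n) : parity *m Q R i = - (Q R i *m parity).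
Proof.
rewrite !tensorM; apply: (tensorN (i := i)) => [|k ki].
  by rewrite ltnn eqxx pauliUQ.
by rewrite (negPf ki); case: ifP => // _; rewrite mulmx1 mul1mx.
Qed.

(** At the smaller of the two sites one factor is the anticommuting pair of Pauli
    matrices; at every other site the factors commute. *)
Lemma Q_anti (i j : 'I_n) : i != j -> Q R i *m Q R j = - (Q R j *m Q R i).
Proof.
have anti (k l : 'I_n) : (k < l)%N -> Q R k *m Q R l = - (Q R l *m Q R k).
  move=> kl; rewrite !tensorM; apply: (tensorN (i := k)) => [|m mk].
    by rewrite ltnn eqxx kl pauliUQ opprK.
  rewrite (negPf mk); case: (ltngtP m k) => [mlt|_|/ord_inj/eqP]; last by rewrite (negPf mk).
    by rewrite (ltn_trans mlt kl).
  by rewrite mulmx1 mul1mx.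
move=> ij; case: (ltngtP i j) => [/anti //|/anti ->|/ord_inj/eqP]; first by rewrite opprK.
by rewrite (negPf ij).
Qed.

Lemma hdimE : hdim n = (2 ^ n)%N.
Proof. by rewrite /hdim card_ffun !card_ord. Qed.

End Tensor.

(** * Consequences of the Clifford relations *)

Section CliffordRelations.
Variables (C : numClosedFieldType) (N n : nat) (q : 'I_n -> 'M[C]_N) (p : 'M[C]_N).
Hypotheses (q_sq : forall i, q i *m q i = 1%:M)
  (q_adj : forall i, (q i)^t* = q i)
  (q_anti : forall i j, i != j -> q i *m q j = - (q j *m q i))
  (p_sq : p *m p = 1%:M) (p_adj : p^t* = p)
  (p_q : forall i, p *m q i = - (q i *m p)).
Local Notation op := 'M[C]_N.
Local Notation multi := {ffun 'I_n -> bool}.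

Definition twist (W A : op) : op := W *m A *m W^t*.

Lemma twistM W A B : W^t* *m W = 1%:M -> twist W (A *m B) = twist W A *m twist W B.
Proof.
by move=> uW; rewrite /twist !mulmxA -[_ *m W^t* *m W]mulmxA uW mulmx1.
Qed.

Lemma twist_adj W A : twist W (A^t*) = (twist W A)^t*.
Proof. by rewrite /twist !adjmxM trmxCK mulmxA. Qed.

Lemma twistD W A B : twist W (A + B) = twist W A + twist W B.
Proof. by rewrite /twist mulmxDr mulmxDl. Qed.

Lemma twistZ W c A : twist W (c *: A) = c *: twist W A.
Proof. by rewrite /twist -scalemxAr -scalemxAl. Qed.

Lemma twist_tr W A : W^t* *m W = 1%:M -> \tr (twist W A) = \tr A.
Proof. by move=> uW; rewrite /twist mxtrace_mulC mulmxA uW mul1mx. Qed.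

Definition qpow (al : multi) : op := \prod_(j < n) q j ^+ al j.

(** Conjugation by this unitary flips the sign of the generator i and fixes the
    other generators, which exhibits that automorphism as an inner one of the
    full matrix algebra. *)
Definition reflection (i : 'I_n) : op := q i *m p.

Lemma reflection_adj i : (reflection i)^t* = p *m q i.
Proof. by rewrite /reflection adjmxM p_adj q_adj. Qed.

Lemma reflection_unitary i : (reflection i)^t* *m reflection i = 1%:M.
Proof.
by rewrite reflection_adj /reflection mulmxA -[p *m q i *m q i]mulmxA q_sq mulmx1 p_sq.
Qed.

Lemma parity_unitary : p^t* *m p = 1%:M.
Proof. by rewrite p_adj p_sq. Qed.

Lemma twist_parity_q j : twist p (q j) = (-1) ^+ true *: q j.
Proof.
by rewrite /twist p_adj p_q mulNmx -mulmxA p_sq mulmx1 expr1 scaleN1r.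
Qed.

Lemma twist_reflectionE i A : twist (reflection i) A = q i *m twist p A *m q i.
Proof. by rewrite /twist reflection_adj p_adj /reflection !mulmxA. Qed.

Lemma twist_reflection_q i j : twist (reflection i) (q j) = (-1) ^+ (i == j) *: q j.
Proof.
rewrite twist_reflectionE twist_parity_q expr1 scaleN1r mulmxN mulNmx.
have [->|ij] := eqVneq i j; first by rewrite -mulmxA q_sq mulmx1 scaleN1r.
by rewrite q_anti // mulNmx opprK -mulmxA q_sq mulmx1 scale1r.
Qed.

Lemma twist_qpow W (s : 'I_n -> bool) (al : multi) : W^t* *m W = 1%:M ->
  (forall j, twist W (q j) = (-1) ^+ s j *: q j) ->
  twist W (qpow al) = (-1) ^+ (\sum_j (s j && al j))%N *: qpow al.
Proof.
move=> uW hW; rewrite /qpow.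
have t1 : twist W 1%R = 1%R.
  by rewrite /twist mulmx1; apply/mulmx1C.
apply: (big_rec2 (fun (A : op) (k : nat) => twist W A = (-1) ^+ k *: A)).
  by rewrite t1 expr0 scale1r.
move=> j A k _ IH; rewrite -[_ * A]/(_ *m A) twistM // IH exprD.
have -> : twist W (q j ^+ al j) = (-1) ^+ (s j && al j) *: q j ^+ al j.
  by case: (al j); rewrite ?andbT ?andbF ?expr0 ?expr1 ?scale1r.
by rewrite -scalemxAl -scalemxAr scalerA.
Qed.

Lemma twist_parity_qpow al : twist p (qpow al) = (-1) ^+ (\sum_j al j)%N *: qpow al.
Proof. by rewrite (twist_qpow _ parity_unitary twist_parity_q). Qed.

Lemma twist_reflection_qpow i al :
  twist (reflection i) (qpow al) = (-1) ^+ al i *: qpow al.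
Proof.
rewrite (twist_qpow _ (reflection_unitary i) (twist_reflection_q i)).
rewrite (bigD1 i) //= eqxx /= big1 ?addn0 // => j ji.
by rewrite eq_sym (negPf ji).
Qed.

Lemma qpow_unitary al : (qpow al)^t* *m qpow al = 1%:M.
Proof.
rewrite /qpow; apply: (big_ind (fun A : op => A^t* *m A = 1%:M)).
- by rewrite mulmx1 trmx1 map_mx1.
- move=> A B uA uB; rewrite -[A * B]/(A *m B) adjmxM mulmxA -[_ *m A^t* *m A]mulmxA uA.
  by rewrite mulmx1.
- move=> j _; case: (al j); first by rewrite expr1 q_adj q_sq.
  by rewrite expr0 mulmx1 trmx1 map_mx1.
Qed.

(** Distinct monomials have opposite parities under some reflection, which
    preserves the trace. *)
Lemma qpow_orthogonal al be : al != be -> \tr ((qpow al)^t* *m qpow be) = 0.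
Proof.
move=> ab; have [i abi] : exists i, al i != be i.
  case: (boolP [exists i, al i != be i]) => [/existsP //|/existsPn h].
  by case/eqP: ab; apply/ffunP => i; apply/eqP; have := h i; rewrite negbK.
have uV := reflection_unitary i.
have := twist_tr ((qpow al)^t* *m qpow be) uV.
rewrite twistM // twist_adj !twist_reflection_qpow.
have -> : ((-1) ^+ al i *: qpow al)^t* = (-1) ^+ al i *: (qpow al)^t*.
  apply/matrixP=> k l; rewrite !mxE rmorphM; congr (_ * _).
  by rewrite rmorphXn rmorphN1.
rewrite -scalemxAl -scalemxAr scalerA mxtraceZ -exprD.
have -> : (-1) ^+ (al i + be i) = -1 :> C.
  by case: (al i) (be i) abi => [] [].
rewrite mulN1r => /eqP; rewrite eq_sym -subr_eq0 opprK -mulr2n mulrn_eq0 /=.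
by move/eqP.
Qed.

Definition inspan (A : op) := exists c : multi -> C, A = \sum_al c al *: qpow al.

Lemma inspan0 : inspan 0.
Proof. by exists (fun=> 0); rewrite big1 // => al _; rewrite scale0r. Qed.

Lemma inspanD A B : inspan A -> inspan B -> inspan (A + B).
Proof.
move=> [c ->] [d ->]; exists (fun al => c al + d al); rewrite -big_split.
by apply: eq_bigr => al _; rewrite scalerDl.
Qed.

Lemma inspanZ k A : inspan A -> inspan (k *: A).
Proof.
move=> [c ->]; exists (fun al => k * c al); rewrite scaler_sumr.
by apply: eq_bigr => al _; rewrite scalerA.
Qed.

Lemma inspan_qpow al : inspan (qpow al).
Proof.
exists (fun be => (be == al)%:R); rewrite (bigD1 al) //= eqxx scale1r big1 ?addr0 //.
by move=> be /negPf ->; rewrite scale0r.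
Qed.

Definition flip (i : 'I_n) (al : multi) : multi := [ffun j => (j == i) (+) al j].

(** The generator is moved through the ordered product up to its own position,
    where it cancels or completes the factor. *)
Lemma q_qpow i al : exists k : nat, q i *m qpow al = (-1) ^+ k *: qpow (flip i al).
Proof.
rewrite /qpow; have : i \in index_enum 'I_n by rewrite mem_index_enum.
have := index_enum_uniq 'I_n; elim: (index_enum _) => [|j l IH] //=.
move=> /andP[jl ul]; rewrite inE !big_cons.
case: (eqVneq i j) jl => [<- jl _|ij jl /= il].
  exists 0; rewrite expr0 scale1r ffunE eqxx /=.
  rewrite -[_ * _]/(_ *m _) -[in RHS]/(_ *m _) mulmxA.
  have -> : \prod_(k <- l) q k ^+ flip i al k = \prod_(k <- l) q k ^+ al k.
    apply: eq_big_seq => k kl; rewrite ffunE.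
    by case: eqP kl => [->|_ _ //]; rewrite (negPf jl).
  by case: (al i); rewrite ?expr0 ?expr1 ?q_sq ?mulmx1.
have [k e] := IH ul il; rewrite ffunE eq_sym (negPf ij) /=.
case: (al j); last by exists k; rewrite !expr0 !mul1r.
exists k.+1; rewrite !expr1 -[_ * _]/(_ *m _) -[in RHS]/(_ *m _) mulmxA q_anti //.
by rewrite mulNmx -mulmxA e -scalemxAr exprS -scalerA scaleN1r.
Qed.

Lemma inspan_q i A : inspan A -> inspan (q i *m A).
Proof.
move=> [c ->]; rewrite mulmx_sumr; apply: big_ind => [||al _]; first exact: inspan0.
  exact: inspanD.
by rewrite -scalemxAr; have [k ->] := q_qpow i al; do 2 apply: inspanZ; exact: inspan_qpow.
Qed.

(** By q_i^2 = 1 this is (q_i A - p A p q_i) / 2, the derivation that is written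
    with the grading; in this form it visibly removes the part of A that is
    even in the generator i. *)
Definition half_grad i A := 2^-1 *: (q i *m (A - twist (reflection i) A)).

Definition half_div i A := 2^-1 *: (q i *m (A + twist (reflection i) A)).

Lemma half_gradE i A : half_grad i A = 2^-1 *: (q i *m A - twist p A *m q i).
Proof.
by rewrite /half_grad twist_reflectionE mulmxBr !mulmxA q_sq mul1mx.
Qed.

Lemma half_divE i A : half_div i A = 2^-1 *: (q i *m A + twist p A *m q i).
Proof.
by rewrite /half_div twist_reflectionE mulmxDr !mulmxA q_sq mul1mx.
Qed.

Lemma half_gradD i A B : half_grad i (A + B) = half_grad i A + half_grad i B.
Proof. by rewrite /half_grad twistD opprD addrACA mulmxDr scalerDr. Qed.

Lemma half_gradZ i c A : half_grad i (c *: A) = c *: half_grad i A.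
Proof. by rewrite /half_grad twistZ -scalerBr -scalemxAr !scalerA mulrC. Qed.

Lemma half_grad0 i : half_grad i 0 = 0.
Proof. by rewrite -(scale0r (0 : op)) half_gradZ !scale0r. Qed.

Lemma half_divD i A B : half_div i (A + B) = half_div i A + half_div i B.
Proof. by rewrite /half_div twistD addrACA mulmxDr scalerDr. Qed.

Lemma half_divZ i c A : half_div i (c *: A) = c *: half_div i A.
Proof. by rewrite /half_div twistZ -scalerDr -scalemxAr !scalerA mulrC. Qed.

Lemma half_double (A : op) : 2^-1 *: (A + A) = A.
Proof. by rewrite -mulr2n -[A *+ 2]scaler_nat scalerA mulVf ?scale1r // pnatr_eq0. Qed.

Lemma half_grad_qpow i al :
  half_grad i (qpow al) = if al i then q i *m qpow al else 0.
Proof.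
rewrite /half_grad twist_reflection_qpow; case: (al i); last first.
  by rewrite expr0 scale1r subrr mulmx0 scaler0.
by rewrite expr1 scaleN1r opprK mulmxDr half_double.
Qed.

Lemma half_div_grad_qpow i al :
  half_div i (half_grad i (qpow al)) = if al i then qpow al else 0.
Proof.
rewrite half_grad_qpow /half_div; case: ifP => ali; last first.
  by rewrite /twist mulmx0 mul0mx addr0 mulmx0 scaler0.
rewrite twistM ?reflection_unitary // twist_reflection_q twist_reflection_qpow eqxx ali.
rewrite -scalemxAl -scalemxAr scalerA -expr2 sqrrN expr1n scale1r.
by rewrite mulmxDr half_double mulmxA q_sq mul1mx.
Qed.

Lemma half_div0 i : half_div i 0 = 0.
Proof. by rewrite -(scale0r (0 : op)) half_divZ !scale0r. Qed.

(** Integration by parts: moving the conjugation by [p] across the trace turns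
    q_i p into - p q_i, which is the change of sign between a derivation and its
    adjoint. *)
Lemma half_grad_adjoint i A B :
  \tr ((half_grad i A)^t* *m B) = \tr (A^t* *m half_div i B).
Proof.
rewrite half_gradE half_divE.
have -> : (2^-1 *: (q i *m A - twist p A *m q i))^t* =
    2^-1 *: (A^t* *m q i - q i *m twist p (A^t*)).
  rewrite twist_adj -[in RHS](q_adj i) -!adjmxM.
  apply/matrixP=> k l; rewrite !mxE rmorphM rmorphB; congr (_ * _).
  by rewrite fmorphV rmorph_nat.
rewrite -scalemxAl -scalemxAr !mxtraceZ mulmxBl mulmxDr; congr (_ * _).
rewrite raddfB raddfD /=; congr (_ + _); first by rewrite mulmxA.
rewrite /twist !p_adj -[p *m B *m p *m q i]mulmxA p_q !mulmxN raddfN /=; congr (- _).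
transitivity (\tr ((q i *m p) *m (A^t* *m p *m B))); first by rewrite !mulmxA.
by rewrite mxtrace_mulC !mulmxA.
Qed.

End CliffordRelations.

(** * The Clifford algebra and its grading *)

Section Fermions.
Variables (R : realType) (n : nat).
Local Notation C := R[i].
Local Notation op := 'M[C]_(hdim n).
Local Notation multi := {ffun 'I_n -> bool}.
Local Notation q := (Q R (n:=n)).
Local Notation p := (parity R n).
Local Notation qsq := (@Q_sq R n).
Local Notation qadj := (@Q_adj R n).
Local Notation qanti := (@Q_anti R n).
Local Notation psq := (parity_sq R n).
Local Notation padj := (parity_adj R n).
Local Notation pq := (@parityQ R n).
Local Notation refl := (reflection q p).
Local Notation grad1 := (half_grad q p).
Local Notation div1 := (half_div q p).
Implicit Types (S T X M : op) (a b d u : 'I_(hdim n) -> R).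

Definition degree (al : multi) : nat := (\sum_j al j)%N.

(** The monomials are orthogonal for the trace. *)
Lemma Qpow_free : free (codom_tuple (@Qpow R n)).
Proof.
apply/freeP => k e i; pose be := enum_val i : multi.
have e' : \sum_(al : multi) k (enum_rank al) *: qpow q al = 0.
  rewrite -{}[RHS]e (reindex (@enum_rank multi)) /=; last first.
    exact/onW_bij/enum_rank_bij.
  apply: eq_bigr => al _; congr (_ *: _).
  by rewrite nth_codom enum_rankK.
have := congr1 (fun A => \tr ((qpow q be)^t* *m A)) e'.
rewrite mulmx_sumr raddf_sum /= mulmx0 mxtrace0 (bigD1 be) //= big1 => [|al alb].
  rewrite addr0 -scalemxAr (qpow_unitary qsq qadj) mxtraceZ mxtrace1 enum_valK.
  move=> /eqP; rewrite mulf_eq0 pnatr_eq0 hdimE expn_eq0 /= orbF => /eqP; exact.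
rewrite -scalemxAr mxtraceZ (qpow_orthogonal qsq qadj qanti psq padj pq) ?mulr0 //.
by rewrite eq_sym.
Qed.

(** Stated with a right factor in the span, so that the induction passes through
    products. *)
Lemma clifford_mul_inspan (A : op) : clifford A ->
  forall B, inspan q B -> inspan q (A *m B).
Proof.
elim=> {A} [j|c|A B _ IA _ IB|A B _ IA _ IB] D sD.
- exact: (inspan_q qsq qanti).
- by rewrite mul_scalar_mx; apply: inspanZ.
- by rewrite mulmxDl; apply: inspanD; [apply: IA | apply: IB].
- by rewrite -mulmxA; apply: IA; apply: IB.
Qed.

Lemma inspan1 : inspan q 1%:M.
Proof.
have -> : 1%:M = qpow q [ffun=> false] :> op.
  rewrite /qpow big1 // => j _; by rewrite ffunE expr0.
exact: inspan_qpow.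
Qed.

Lemma clifford_inspan (A : op) : clifford A -> inspan q A.
Proof. by move=> cA; rewrite -[A]mulmx1; apply: (clifford_mul_inspan cA inspan1). Qed.

Lemma cliffordZ c (A : op) : clifford A -> clifford (c *: A).
Proof.
by move=> cA; rewrite -mul_scalar_mx; apply: clifford_mul => //; apply: clifford_scalar.
Qed.

Lemma clifford0 : clifford (0 : op).
Proof. by rewrite -(scale0r (1%:M : op)) scalemx1; apply: clifford_scalar. Qed.

Lemma clifford_sum I (r : seq I) (P : pred I) (F : I -> op) :
  (forall i, P i -> clifford (F i)) -> clifford (\sum_(i <- r | P i) F i).
Proof. by move=> cF; apply: big_ind => //; [exact: clifford0 | exact: clifford_add]. Qed.

Lemma clifford_qpow (al : multi) : clifford (qpow q al).
Proof.
apply: big_ind => [|A B|j _]; [exact: clifford_scalar | exact: clifford_mul |].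
by case: (al j); [rewrite expr1; exact: clifford_gen | rewrite expr0; exact: clifford_scalar].
Qed.

Lemma inspan_clifford (A : op) : inspan q A -> clifford A.
Proof.
by move=> [c ->]; apply: clifford_sum => al _; apply: cliffordZ; apply: clifford_qpow.
Qed.

Lemma clifford_twist_parity (A : op) : clifford A -> clifford (twist p A).
Proof.
move=> /clifford_inspan[c ->]; rewrite /twist mulmx_sumr mulmx_suml.
apply: clifford_sum => al _; rewrite -scalemxAr -scalemxAl.
apply: cliffordZ; rewrite -/(twist p _) (twist_parity_qpow psq padj pq).
by apply: cliffordZ; apply: clifford_qpow.
Qed.

(** [Gamma] is defined by coordinates; on the algebra these see the same signs as
    conjugation by the grading operator. *)
Lemma Gamma_clifford (A : op) : clifford A -> Gamma A = twist p A.
Proof.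
move=> /clifford_inspan[c ->]; rewrite /Gamma /twist mulmx_sumr mulmx_suml.
apply: eq_bigr => al _; rewrite -scalemxAr -scalemxAl -/(twist p _).
rewrite (twist_parity_qpow psq padj pq) scalerA [c al * _]mulrC.
have -> : coord (codom_tuple (@Qpow R n)) (enum_rank al)
    (\sum_(be : multi) c be *: qpow q be) = c al; last by [].
rewrite (reindex (@enum_val _ multi)) /=; last exact/onW_bij/enum_val_bij.
rewrite -[al in RHS]enum_rankK.
have <- := coord_sum_free (fun i => c (enum_val i)) (enum_rank al) Qpow_free.
congr coord; apply: eq_bigr => i _; congr (_ *: _).
by rewrite nth_codom.
Qed.

Lemma nabla_clifford i (A : op) : clifford A -> nabla i A = grad1 i A.
Proof. by move=> cA; rewrite /nabla (Gamma_clifford cA) (half_gradE qsq qadj padj). Qed.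

Lemma nabla_adj_clifford i (A : op) : clifford A -> nabla_adj i A = div1 i A.
Proof. by move=> cA; rewrite /nabla_adj (Gamma_clifford cA) (half_divE qsq qadj padj). Qed.

Lemma clifford_half_grad i (A : op) : clifford A -> clifford (grad1 i A).
Proof.
move=> cA; rewrite (half_gradE qsq qadj padj); apply: cliffordZ; apply: clifford_add.
  by apply: clifford_mul => //; apply: clifford_gen.
rewrite -scaleN1r; apply: cliffordZ; apply: clifford_mul; last exact: clifford_gen.
exact: clifford_twist_parity.
Qed.

(** * The number semigroup as an average of automorphisms *)

Lemma reflection_unitarymx i : refl i \is unitarymx.
Proof.
apply/unitarymxP/mulmx1C; exact: (reflection_unitary qsq qadj psq padj).
Qed.

Lemma parity_unitarymx : p \is unitarymx.
Proof. by apply/unitarymxP; rewrite padj psq. Qed.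

Lemma mixcE x (V A : op) :
  mixc x V A = ((1 + x) / 2)%:C *: A + ((1 - x) / 2)%:C *: twist V A.
Proof. by []. Qed.

Lemma mixcD x (V A B : op) : mixc x V (A + B) = mixc x V A + mixc x V B.
Proof. by rewrite !mixcE twistD !scalerDr addrACA. Qed.

Lemma mixcZ x (V A : op) c : mixc x V (c *: A) = c *: mixc x V A.
Proof.
rewrite !mixcE twistZ scalerDr !scalerA.
by rewrite [_ * c]mulrC [((1 - x) / 2)%:C * c]mulrC.
Qed.

Lemma mixc_eigen x (V A : op) (b : bool) : twist V A = (-1) ^+ b *: A ->
  mixc x V A = (x ^+ b)%:C *: A.
Proof.
move=> hA; rewrite mixcE hA scalerA -scalerDl; congr (_ *: _).
have -> : (-1) ^+ b = ((-1) ^+ b)%:C :> C by rewrite rmorphXn rmorphN1.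
rewrite -rmorphM -rmorphD; congr (_%:C).
by case: b {hA}; rewrite ?expr1 ?expr0; field.
Qed.

Definition mix_along (x : R) (l : seq 'I_n) (A : op) : op :=
  foldr (fun i B => mixc x (refl i) B) A l.

(** The operator x^N, where N is the number operator. It is diagonal on the
    monomials, and for x in [0, 1] it is an average of automorphisms: the
    first description computes the curve, the second one gives monotonicity. *)
Definition mix (x : R) : op -> op := mix_along x (index_enum 'I_n).

Lemma mix_alongD x l A B : mix_along x l (A + B) = mix_along x l A + mix_along x l B.
Proof. by elim: l => [|i l IH] //=; rewrite IH mixcD. Qed.

Lemma mix_alongZ x l c A : mix_along x l (c *: A) = c *: mix_along x l A.
Proof. by elim: l => [|i l IH] //=; rewrite IH mixcZ. Qed.

Lemma mix_along_eigen x l (A : op) (s : 'I_n -> bool) :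
  (forall i, twist (refl i) A = (-1) ^+ s i *: A) ->
  mix_along x l A = (x ^+ (\sum_(i <- l) s i)%N)%:C *: A.
Proof.
move=> hA; elim: l => [|i l IH] /=; first by rewrite big_nil expr0 scale1r.
rewrite IH mixcZ (mixc_eigen _ (hA i)) big_cons scalerA -rmorphM exprD mulrC.
by [].
Qed.

Lemma mix_sum x (F : multi -> op) : mix x (\sum_al F al) = \sum_al mix x (F al).
Proof.
apply: (big_morph (mix x)); first exact: mix_alongD.
by rewrite -(scale0r (0 : op)) /mix mix_alongZ !scale0r.
Qed.

Lemma mix_qpow x al : mix x (qpow q al) = (x ^+ degree al)%:C *: qpow q al.
Proof.
by apply: mix_along_eigen => i; apply: (twist_reflection_qpow qsq qadj qanti psq padj pq).
Qed.

(** Multiplication by the generator k lowers the degree of a monomial that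
    contains it by one, which the extra factor x compensates. *)
Lemma mix_q_qpow x k (al : multi) : al k ->
  x%:C *: mix x (q k *m qpow q al) = (x ^+ degree al)%:C *: (q k *m qpow q al).
Proof.
move=> alk; pose s i := (i == k) (+) al i.
rewrite /mix (@mix_along_eigen x _ _ s) => [|i].
  rewrite scalerA -rmorphM -exprS; congr ((x ^+ _)%:C *: _).
  rewrite /degree [in RHS](bigD1 k) //= alk [in LHS](bigD1 k) //= /s eqxx alk.
  by rewrite add0n add1n; congr _.+1; apply: eq_bigr => i /negPf ->.
rewrite (twistM _ _ (reflection_unitary qsq qadj psq padj i)).
rewrite (twist_reflection_q qsq qadj qanti psq padj pq).
rewrite (twist_reflection_qpow qsq qadj qanti psq padj pq).
rewrite -scalemxAl -scalemxAr scalerA /s.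
by case: eqP; case: (al i); rewrite ?expr0 ?expr1 ?mulrNN ?mulr1 ?mul1r.
Qed.

Implicit Types c : multi -> C.

(** This is r^N applied to the element with coordinates [c]. *)
Definition flow (c : multi -> C) (r : R) : op :=
  \sum_al ((r ^+ degree al)%:C * c al) *: qpow q al.

Lemma flow_inspan c r : inspan q (flow c r).
Proof. by eexists; reflexivity. Qed.

Lemma clifford_flow c r : clifford (flow c r).
Proof. exact: inspan_clifford (flow_inspan c r). Qed.

Lemma flow1 c : flow c 1 = \sum_al c al *: qpow q al.
Proof. by apply: eq_bigr => al _; rewrite expr1n mul1r. Qed.

Lemma mix_flow x c r : mix x (flow c r) = flow c (x * r).
Proof.
rewrite /flow mix_sum; apply: eq_bigr => al _.
by rewrite /mix mix_alongZ -/(mix x _) mix_qpow scalerA mulrC mulrA -rmorphM exprMn.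
Qed.

Lemma mix_parity_flow x c r : mix x (twist p (flow c r)) = twist p (flow c (x * r)).
Proof.
rewrite /flow /twist !mulmx_sumr !mulmx_suml mix_sum; apply: eq_bigr => al _.
rewrite -!scalemxAr -!scalemxAl -/(twist p _) (twist_parity_qpow psq padj pq).
rewrite /mix !mix_alongZ -/(mix x _) mix_qpow !scalerA exprMn rmorphM.
by congr (_ *: _); ring.
Qed.

Lemma half_grad_flow k c r :
  grad1 k (flow c r) = \sum_al ((r ^+ degree al)%:C * c al) *: grad1 k (qpow q al).
Proof.
rewrite /flow (big_morph (grad1 k) (half_gradD q p k) (half_grad0 q p k)).
by apply: eq_bigr => al _; rewrite half_gradZ.
Qed.

(** The commutation of the gradient with x^N, up to a factor x: this is where a
    unit lower bound on the curvature comes from. *)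
Lemma half_grad_mix k x c r :
  grad1 k (flow c (x * r)) = x%:C *: mix x (grad1 k (flow c r)).
Proof.
rewrite !half_grad_flow mix_sum scaler_sumr; apply: eq_bigr => al _.
rewrite (half_grad_qpow qsq qadj qanti psq padj pq); case: ifP => alk; last first.
  by rewrite !scaler0 /mix -(scale0r (0 : op)) mix_alongZ !scale0r scaler0.
rewrite /mix mix_alongZ -/(mix x _) [RHS]scalerA [x%:C * _]mulrC -[RHS]scalerA.
rewrite mix_q_qpow // [RHS]scalerA exprMn rmorphM.
by congr (_ *: _); ring.
Qed.

Lemma legendre_bound_mix m s x A B X : 0 <= x <= 1 ->
  legendre_bound m s A B X -> legendre_bound m s (mix x A) (mix x B) (mix x X).
Proof.
move=> /andP[x0 x1] h; have x11 : -1 <= x <= 1.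
  by rewrite x1 andbT (le_trans (lerN10 _) x0).
rewrite /mix; elim: (index_enum 'I_n) => [|i l IH]; first exact: h.
exact: (legendre_bound_mixc x11 (reflection_unitarymx i) IH).
Qed.

Lemma positive_mix x (A : op) : 0 <= x <= 1 -> positive A -> positive (mix x A).
Proof.
move=> /andP[x0 x1] pA; rewrite /mix.
have u0 : 0 <= (1 + x) / 2 by rewrite divr_ge0 // addr_ge0.
have v0 : 0 <= (1 - x) / 2 by rewrite divr_ge0 // subr_ge0.
elim: (index_enum 'I_n) => [|i l IH]; first exact: pA.
exact: (positiveD (positiveZ u0 IH) (positiveZ v0 (positive_conj _ IH))).
Qed.

(** * Fisher information and its monotonicity *)

Lemma triple_sum (V : nmodType) (I J K : finType) (F : I -> J -> K -> V) :
  \sum_i \sum_j \sum_k F i j k = \sum_(t : I * (J * K)) F t.1 t.2.1 t.2.2.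
Proof. by under eq_bigr do rewrite pair_bigA; rewrite pair_bigA. Qed.

Lemma unitary_mul_parity S : S \is unitarymx -> S *m p^t* \is unitarymx.
Proof.
by move=> uS; apply: (mul_unitarymx uS); rewrite padj; apply: parity_unitarymx.
Qed.

(** In the eigenbasis of the argument, and in that basis rotated by the grading
    operator on the left, the derivation multiplies the matrix of q_k entrywise
    by differences of eigenvalues. *)
Lemma rotated_half_grad S u k i j : S \is unitarymx ->
  (S *m p^t* *m grad1 k (spec S u) *m S^t*) i j =
  ((u j - u i) / 2)%:C * (S *m p^t* *m q k *m S^t*) i j.
Proof.
move=> uS; have uT := unitary_mul_parity uS; set T := S *m p^t* in uT *.
have -> : grad1 k (spec S u) = 2^-1%:C *: (q k *m spec S u - spec T u *m q k).
  rewrite (half_gradE qsq qadj padj) /T spec_conj.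
  by congr (_ *: _); rewrite fmorphV rmorph_nat.
rewrite -scalemxAr -scalemxAl mulmxBr mulmxBl mxE.
rewrite (mul_spec_rotated u (q k) uS uT) (spec_mul_rotated u (q k) uT uS).
rewrite mxE [X in _ + X]mxE mul_rdiagE rdiag_mulE -mulrBl mulrA -rmorphB -rmorphM.
by rewrite [2^-1 * _]mulrC.
Qed.

(** Up to the normalisation of the trace, minus the derivative of the entropy
    along r^N rho, r = exp (- t), at t = 0. *)
Definition fisher (rho : op) : R :=
  \sum_k hsdot (grad1 k (logmx rho)) (grad1 k rho).

Definition fisher_weight S (t : 'I_n * ('I_(hdim n) * 'I_(hdim n))) : R :=
  sqmod ((S *m p^t* *m q t.1 *m S^t*) t.2.1 t.2.2) / 4.

Lemma fisher_spec S b : S \is unitarymx ->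
  fisher (spec S b) = \sum_t fisher_weight S t *
      (b t.2.2 - b t.2.1) * (ln (b t.2.2) - ln (b t.2.1)).
Proof.
move=> uS; have uT := unitary_mul_parity uS.
rewrite -(triple_sum (fun k i j => fisher_weight S (k, (i, j)) *
      (b j - b i) * (ln (b j) - ln (b i)))).
apply: eq_bigr => k _.
rewrite /logmx (fcalc_spec b (@ln R) uS) -(hsdot_unitary _ _ uT uS) hsdotE.
apply: eq_bigr => i _; apply: eq_bigr => j _.
pose h (z w : C) := complex.Re z * complex.Re w + complex.Im z * complex.Im w.
rewrite -[LHS]/(h _ _).
have -> := congr2 h (rotated_half_grad (@ln R \o b) k i j uS)
  (rotated_half_grad b k i j uS).
by rewrite /h !ReZ !ImZ /fisher_weight /sqmod /=; field.
Qed.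

Lemma fisher_ge0 S b : S \is unitarymx -> (forall i, 0 < b i) ->
  0 <= fisher (spec S b).
Proof.
move=> uS b0; rewrite fisher_spec // sumr_ge0 // => -[k [i j]] _.
rewrite /= -mulrA mulr_ge0 // ?divr_ge0 ?sqmod_ge0 //.
have [lt|lt|->] := ltgtP (b i) (b j); last by rewrite !subrr mulr0.
- by rewrite mulr_ge0 // subr_ge0 ?(ltW lt) // ler_ln ?posrE // ltW.
- by rewrite mulr_le0 // subr_le0 ?(ltW lt) // ler_ln ?posrE // ltW.
Qed.

(** For each s the inverse form at the gradient decreases under [mix], by convexity and since [mix] commutes with
    the grading; the gradient of the mixed element is x times the mixed gradient. *)
Lemma fisher_mix c x r S b T d : 0 < x -> x <= 1 ->
  S \is unitarymx -> T \is unitarymx -> (forall i, 0 < b i) -> (forall i, 0 < d i) ->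
  flow c r = spec S b -> flow c (x * r) = spec T d ->
  fisher (flow c (x * r)) <= x ^+ 2 * fisher (flow c r).
Proof.
move=> x0 x1 uS uT b0 d0 eS eT; rewrite eS eT !fisher_spec //.
rewrite -ler_pdivrMl ?exprn_gt0 // mulr_sumr.
under eq_bigr do rewrite 2!mulrA.
apply: (log_difference_le (w := fisher_weight S) (a := fun t => b t.2.1)
  (b := fun t => b t.2.2) (w' := fun t => x ^- 2 * fisher_weight T t)
  (a' := fun t => d t.2.1) (b' := fun t => d t.2.2)) => // s s01.
have uSp := unitary_mul_parity uS; have uTp := unitary_mul_parity uT.
have e V u (y : R) : V \is unitarymx ->
    \sum_t y ^+ 2 * fisher_weight V t * (u t.2.2 - u t.2.1) ^+ 2 /
      (s * u t.2.1 + (1 - s) * u t.2.2) =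
    \sum_k invform s (V *m p^t*) u V u (y%:C *: grad1 k (spec V u)).
  move=> uV; rewrite -(triple_sum (fun k i j =>
    y ^+ 2 * fisher_weight V (k, (i, j)) * (u j - u i) ^+ 2 /
      (s * u i + (1 - s) * u j))).
  apply: eq_bigr => k _; apply: eq_bigr => i _; apply: eq_bigr => j _.
  congr (_ / _); rewrite -scalemxAr -scalemxAl [in RHS]mxE (rotated_half_grad u k i j uV).
  by rewrite /sqmod !ReZ !ImZ /fisher_weight /sqmod /=; field.
have := e T d x^-1 uT; rewrite exprVn => ->.
have := e S b 1 uS; rewrite expr1n.
under eq_bigr do rewrite mul1r.
move=> ->.
apply: ler_sum => k _.
have [Y eY] := legendre_max ((x^-1)%:C *: grad1 k (spec T d)) s01 uTp uT d0 d0.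
rewrite -eY.
rewrite scale1r.
have bnd : legendre_bound (invform s (S *m p^t*) b S b (grad1 k (spec S b))) s
    (spec (S *m p^t*) b) (spec S b) (grad1 k (spec S b)).
  exact: (fun Z => legendre_le _ Z s01 uSp uS b0 b0).
have x01 : 0 <= x <= 1 by rewrite ltW.
have := legendre_bound_mix x01 bnd Y.
rewrite -eS (spec_conj p S b) -eS -/(twist p _) mix_parity_flow mix_flow.
rewrite (spec_conj p T d) -eT -/(twist p _) half_grad_mix scalerA -rmorphM mulVf ?gt_eqF //.
by rewrite scale1r.
Qed.

(** * Entropy along the flow *)

Lemma hsdot_grad k (A B : op) : hsdot (grad1 k A) B = hsdot A (div1 k B).
Proof. by rewrite /hsdot (half_grad_adjoint qsq qadj padj pq). Qed.

Lemma Re_tau (A : op) : complex.Re (tau A) = 2 ^- n * complex.Re (\tr A).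
Proof.
rewrite /tau -ReZ; congr (complex.Re (_ * _)).
by rewrite fmorphV rmorphXn rmorph_nat.
Qed.

Lemma entropyE S b : S \is unitarymx ->
  entropy (spec S b) = 2 ^- n * hsdot (logmx (spec S b)) (spec S b).
Proof.
move=> uS; rewrite /entropy Re_tau /logmx (fcalc_spec b (@ln R) uS) /hsdot.
rewrite (spec_adj S (@ln R \o b)) (spec_mul b (@ln R \o b) uS).
rewrite (spec_mul (@ln R \o b) b uS).
by rewrite (eq_spec S (fun i => mulrC (b i) ((@ln R \o b) i))).
Qed.

Lemma tr_mix x (A : op) : \tr (mix x A) = \tr A.
Proof.
rewrite /mix; elim: (index_enum 'I_n) => [|i l IH]; first by [].
rewrite [mix_along _ _ _]/= -[RHS]IH; move: (mix_along x l A) => B.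
rewrite mixcE mxtraceD !mxtraceZ (twist_tr _ (reflection_unitary qsq qadj psq padj i)).
rewrite -mulrDl -rmorphD; have -> : (1 + x) / 2 + (1 - x) / 2 = 1 by field.
by rewrite mul1r.
Qed.

Lemma mix1 x : mix x (1%:M : op) = 1%:M.
Proof.
have -> : 1%:M = qpow q [ffun=> false] :> op.
  by rewrite /qpow big1 // => j _; rewrite ffunE expr0.
rewrite mix_qpow /degree big1 ?expr0 ?scale1r // => j _; by rewrite ffunE.
Qed.

Lemma flow_mix c r : flow c r = mix r (flow c 1).
Proof. by rewrite mix_flow mulr1. Qed.

(** Averages of automorphisms fix the scalars and preserve positivity, so the
    smallest eigenvalue at parameter 1 bounds the spectrum at every parameter. *)
Lemma flow_lower_bound c : positive (flow c 1) -> flow c 1 \in unitmx ->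
  exists2 l : R, 0 < l & forall r, 0 <= r <= 1 -> positive (flow c r - l%:C%:M).
Proof.
move=> pos unit; have [S [b [uS e b0]]] := positive_unit_spec pos unit.
(* The neutral element 1 only serves to keep l positive if no index exists. *)
pose l := \big[Num.min/1]_i b i.
have l0 : 0 < l by apply: (big_ind (fun x : R => 0 < x)) => // x y; rewrite lt_min => -> ->.
have lb i : l <= b i by rewrite /l (bigD1 i) //= ge_min lexx.
exists l; first exact: l0.
move=> r r01.
have -> : flow c r - l%:C%:M = mix r (spec S (fun i => b i - l)).
  have -> : spec S (fun i => b i - l) = flow c 1 + (- l%:C) *: 1%:M.
    rewrite e -spec_add; congr (_ + _).
    by rewrite (spec_const (- l) uS) rmorphN scalemx1.
  by rewrite /mix mix_alongD mix_alongZ -!/(mix r _) mix1 -flow_mix scaleNr scalemx1.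
by apply: positive_mix => //; apply: positive_spec => i; rewrite subr_ge0.
Qed.

Lemma positive_scalar (l : R) : 0 <= l -> positive (l%:C%:M : op).
Proof.
move=> l0; have u1 : (1%:M : op) \is unitarymx.
  by apply/unitarymxP; rewrite adjmx1 mulmx1.
by rewrite -(spec_const l u1); apply: positive_spec.
Qed.

Lemma flow_spec c l r : 0 < l -> positive (flow c r - l%:C%:M) ->
  exists S b, [/\ S \is unitarymx, flow c r = spec S b & forall i, l <= b i].
Proof.
move=> l0 pos; have pr : positive (flow c r).
  rewrite -[flow c r](subrK l%:C%:M); apply: (positiveD pos).
  by apply: positive_scalar; apply: ltW.
have [S [b [uS e _ _]]] := hermitian_spec (positive_adj pr).
by exists S, b; split=> //; apply: (spec_lower_bound uS); rewrite -e.
Qed.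

Lemma flow_density c : density (flow c 1) ->
  forall r, 0 <= r <= 1 -> density (flow c r).
Proof.
move=> [_ pos unit tr1] r r01; have [l l0 lb] := flow_lower_bound pos unit.
have [S [b [uS e bl]]] := flow_spec l0 (lb _ r01).
split; first exact: clifford_flow.
- by rewrite e; apply: positive_spec => i; apply: le_trans (bl i); apply: ltW.
- by rewrite e; apply: spec_unit => // i; apply: lt_le_trans (bl i).
- by rewrite flow_mix /tau tr_mix.
Qed.

(** Both sides are the number operator applied to the flow: the composition of a
    derivation with its adjoint is the projection onto the monomials that
    contain the generator k. *)
Lemma number_flow c r : \sum_k div1 k (grad1 k (flow c r)) =
  \sum_al ((degree al)%:R * r ^+ degree al)%:C *: (c al *: qpow q al).
Proof.
under eq_bigr => k _.
  rewrite half_grad_flow (big_morph (div1 k) (half_divD q p k) (half_div0 q p k)).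
  under eq_bigr => al _ do rewrite half_divZ (half_div_grad_qpow qsq qadj qanti psq padj pq).
  over.
rewrite exchange_big /=; apply: eq_bigr => al _.
rewrite -scaler_sumr -big_mkcond /= sumr_const.
have -> : #|[pred k | al k]| = degree al.
  by rewrite -sum1_card /degree big_mkcond; apply: eq_bigr => k _; rewrite inE; case: (al k).
rewrite -[_ *+ _]scaler_nat !scalerA; congr (_ *: _).
rewrite rmorphM rmorph_nat; ring.
Qed.

Lemma fisher_number c r S b : S \is unitarymx -> flow c r = spec S b ->
  fisher (flow c r) = \sum_al (degree al)%:R * r ^+ degree al *
    hsdot (logmx (flow c r)) (c al *: qpow q al).
Proof.
move=> uS e; rewrite /fisher; under eq_bigr => k _ do rewrite hsdot_grad.
rewrite -hsdot_sumr number_flow hsdot_sumr; apply: eq_bigr => al _.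
by rewrite hsdotZr.
Qed.

Lemma remainder_le (P D a e x g m : R) : - (D * x ^+ 2 * m) <= (a - e - x * P) * g ->
  x * (P * g) - D * m * x ^+ 2 <= a * g - e * g.
Proof. by rewrite -subr_ge0 => h; rewrite -subr_ge0; apply: le_trans h _; lra. Qed.

Lemma scale_growth (k x r A K E E' : R) : 0 <= k ->
  x * (A * r) - K * x ^+ 2 <= E' - E ->
  x * (r * (k * A)) - k * K * x ^+ 2 <= k * E' - k * E.
Proof.
move=> k0 h; have := ler_wpM2l k0 h.
by rewrite -subr_ge0 => h'; rewrite -subr_ge0; apply: le_trans h' _; lra.
Qed.

(** Klein's inequality bounds the growth of the entropy below by the pairing of
    log rho_r with rho_r' - rho_r. Replacing the difference by its linear part
    costs a quadratic error, uniform since log rho_r is bounded, and the linear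
    part pairs to (r' - r) r times the Fisher information over r^2. *)
Lemma entropy_flow_growth c : density (flow c 1) ->
  exists2 K : R, 0 <= K & forall r r', 0 < r -> r <= r' -> r' <= 1 ->
    (r' - r) * (r * (2 ^- n * fisher (flow c r) / r ^+ 2)) - K * (r' - r) ^+ 2
    <= entropy (flow c r') - entropy (flow c r).
Proof.
move=> [_ pos unit tr1]; have [l l0 lb] := flow_lower_bound pos unit.
pose t1 := complex.Re (\tr (flow c 1)).
have trE r : complex.Re (\tr (flow c r)) = t1 by rewrite flow_mix tr_mix.
(* The eigenvalues lie between l and their sum, the trace t1. *)
pose L := `|ln l| + `|ln t1|.
have lnL r S b : S \is unitarymx -> flow c r = spec S b -> (forall i, l <= b i) ->
    forall i, `|ln (b i)| <= L.
  move=> uS e bl i; have b0 j : 0 < b j by apply: lt_le_trans (bl j).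
  have t1E : t1 = \sum_i b i.
    rewrite -(trE r) e /spec mxtrace_mulC mulmxA (unitary_mulV uS) mul1mx.
    by rewrite /mxtrace Re_sum; apply: eq_bigr => j _; rewrite !mxE eqxx mulr1n.
  have bt : b i <= t1 by rewrite t1E (bigD1 i) //= lerDl sumr_ge0 // => j _; apply: ltW.
  have h1 : ln l <= ln (b i) by rewrite ler_ln ?posrE.
  have h2 : ln (b i) <= ln t1 by rewrite ler_ln ?posrE // (lt_le_trans (b0 i)).
  have := ler_norm (ln t1); have := ler_norm (- ln l); rewrite normrN /L => h3 h4.
  have := normr_ge0 (ln l); have := normr_ge0 (ln t1) => h5 h6.
  by rewrite ler_norml; apply/andP; split; lra.
pose M al := (hdim n)%:R * (L * (1 + hsdot (c al *: qpow q al) (c al *: qpow q al))).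
have L0 : 0 <= L by rewrite addr_ge0.
have M0 al : 0 <= M al.
  rewrite !mulr_ge0 // addr_ge0 // hsdotxx sumr_ge0 // => i _.
  by apply: sumr_ge0 => j _; apply: sqmod_ge0.
pose K' := \sum_al (degree al ^ 2)%:R * M al.
have n0 : 0 < 2 ^- n :> R by rewrite invr_gt0 exprn_gt0.
exists (2 ^- n * K'); first by rewrite mulr_ge0 ?(ltW n0) // sumr_ge0 // => al _; rewrite mulr_ge0.
move=> r r' r0 rr' r'1.
have r01 : 0 <= r <= 1 by rewrite (ltW r0) (le_trans rr').
have r'01 : 0 <= r' <= 1 by rewrite r'1 (le_trans (ltW r0)).
have [S [b [uS eS bl]]] := flow_spec l0 (lb _ r01).
have [T [d [uT eT dl]]] := flow_spec l0 (lb _ r'01).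
have b0 j : 0 < b j by apply: lt_le_trans (bl j).
have d0 j : 0 < d j by apply: lt_le_trans (dl j).
have logS : logmx (flow c r) = spec S (fun i => ln (b i)) by rewrite eS /logmx fcalc_spec.
have logT : logmx (flow c r') = spec T (fun i => ln (d i)) by rewrite eT /logmx fcalc_spec.
have kl : hsdot (logmx (flow c r)) (flow c r') <= hsdot (logmx (flow c r')) (flow c r').
  by rewrite logS logT eT; apply: klein => //; rewrite -eS -eT !trE.
pose h al := hsdot (logmx (flow c r)) (c al *: qpow q al).
have hM al : `|h al| <= M al.
  by rewrite /h logS; apply: hsdot_spec_bound => //; apply: (lnL r S b).
have flowh x : hsdot (logmx (flow c r)) (flow c x) = \sum_al x ^+ degree al * h al.
  rewrite {2}/flow hsdot_sumr; apply: eq_bigr => al _.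
  by rewrite -scalerA hsdotZr.
have -> : entropy (flow c r) = 2 ^- n * hsdot (logmx (flow c r)) (flow c r).
  by rewrite eS; apply: entropyE.
have -> : entropy (flow c r') = 2 ^- n * hsdot (logmx (flow c r')) (flow c r').
  by rewrite eT; apply: entropyE.
have fE : fisher (flow c r) / r ^+ 2 * r =
    \sum_al (r ^+ (degree al).-1 *+ degree al) * h al.
  rewrite (fisher_number uS eS) !mulr_suml; apply: eq_bigr => al _.
  rewrite -/(h al); case: (degree al) => [|k]; first by rewrite mulr0n !mul0r.
  rewrite /= -mulr_natl exprS; field; exact: lt0r_neq0.
have taylor : (r' - r) * (fisher (flow c r) / r ^+ 2 * r) - K' * (r' - r) ^+ 2 <=
    \sum_al r' ^+ degree al * h al - \sum_al r ^+ degree al * h al.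
  rewrite fE /K' mulr_sumr mulr_suml -!sumrB; apply: ler_sum => al _.
  have := pow_taylor_le (degree al) r01 r'01.
  set z := (X in `|X|) => zle.
  have : `|z * h al| <= (degree al ^ 2)%:R * (r' - r) ^+ 2 * M al.
    by rewrite normrM ler_pM.
  rewrite ler_norml => /andP[h1 _]; rewrite /z in h1.
  exact: remainder_le h1.
rewrite -!flowh in taylor.
rewrite -mulrA; apply: scale_growth (ltW n0) _.
by apply: (le_trans taylor); rewrite lerD2r.
Qed.

(** Klein's inequality with respect to the identity. *)
Lemma entropy_flow_ge0 c : density (flow c 1) ->
  forall r, 0 <= r <= 1 -> 0 <= entropy (flow c r).
Proof.
move=> [_ pos unit tr1] r r01; have [l l0 lb] := flow_lower_bound pos unit.
have [T [d [uT eT dl]]] := flow_spec l0 (lb _ r01).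
have d0 j : 0 < d j by apply: lt_le_trans (dl j).
rewrite eT entropyE // mulr_ge0 ?invr_ge0 ?exprn_ge0 //.
have u1 : (1%:M : op) \is unitarymx by apply/unitarymxP; rewrite adjmx1 mulmx1.
have := @klein R _ 1%:M (fun=> 1) T d u1 uT (fun=> ltr01) d0.
rewrite /logmx fcalc_spec //.
have -> : spec (1%:M : op) (fun=> ln 1) = 0.
  by rewrite (eq_spec _ (fun=> ln1 R)) (spec_const 0 u1) raddf0.
have -> : hsdot (0 : op) (spec T d) = 0.
  by rewrite hsdotC /hsdot mulmx0 mxtrace0.
have -> : spec (1%:M : op) (fun=> 1) = 1%:M.
  rewrite /spec adjmx1 mul1mx mulmx1.
  by apply/matrixP=> i j; rewrite !mxE.
apply; rewrite -eT flow_mix tr_mix mxtrace1; transitivity (2 ^+ n : R).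
  by rewrite -(rmorph_nat (real_complex R)) [LHS]/= hdimE natrX.
have := congr1 (@complex.Re R) tr1; rewrite Re_tau => h.
have n0 : 2 ^+ n != 0 :> R by rewrite expf_neq0 // pnatr_eq0.
have nV0 : 2 ^- n != 0 :> R by rewrite invr_neq0.
by apply: (mulfI nV0); rewrite h mulVf.
Qed.

(** * The logarithmic mean of a density and the metric *)

Lemma unrotate_entry S T M k l : (T^t* *m M *m S) k l =
  \sum_(t : 'I_(hdim n) * 'I_(hdim n)) Num.conj (T t.1 k) * S t.2 l * M t.1 t.2.
Proof.
rewrite -(pair_bigA _ (fun i j => Num.conj (T i k) * S j l * M i j)) /=.
rewrite mxE exchange_big /=; apply: eq_bigr => j _.
rewrite mxE mulr_suml; apply: eq_bigr => i _.
by rewrite !mxE mulrAC.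
Qed.

(** Entrywise multiplication by a kernel in the eigenvalues: what becomes of left
    and right functional calculus in eigenbases. *)
Definition schur (f : R -> R -> R) a b M : op :=
  \matrix_(i, j) ((f (a i) (b j))%:C * M i j).

Lemma rotate_cancel S T M : S \is unitarymx -> T \is unitarymx ->
  T^t* *m (T *m M *m S^t*) *m S = M.
Proof.
move=> uS uT; rewrite !mulmxA (unitary_mulVl uT) mul1mx -mulmxA (unitary_mulVl uS).
by rewrite mulmx1.
Qed.

Lemma unrotate_cancel S T M : S \is unitarymx -> T \is unitarymx ->
  T *m (T^t* *m M *m S) *m S^t* = M.
Proof.
move=> uS uT; rewrite !mulmxA (unitary_mulV uT) mul1mx -mulmxA (unitary_mulV uS).
by rewrite mulmx1.
Qed.

Lemma spec_mul_mul S T u v X : S \is unitarymx -> T \is unitarymx ->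
  spec T u *m X *m spec S v =
  T^t* *m (rdiag u *m (T *m X *m S^t*) *m rdiag v) *m S.
Proof.
move=> uS uT; rewrite /spec; move: (rdiag u) (rdiag v) (T^t*) (S^t*) => D E T' S'.
by rewrite !mulmxA.
Qed.

Lemma sharpE S T a b X : S \is unitarymx -> T \is unitarymx ->
  (forall i, 0 < a i) -> (forall i, 0 < b i) ->
  sharp (spec T a) (spec S b) X =
  T^t* *m schur (@logmean R) a b (T *m X *m S^t*) *m S.
Proof.
move=> uS uT a0 b0; set Z := T *m X *m S^t*.
pose w k l (t : 'I_(hdim n) * 'I_(hdim n)) : C :=
  Num.conj (T t.1 k) * S t.2 l * Z t.1 t.2.
have entry (f : R -> R -> R) k l : (T^t* *m schur f a b Z *m S) k l =
    \sum_t w k l t * (f (a t.1) (b t.2))%:C.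
  rewrite unrotate_entry; apply: eq_bigr => t _.
  by rewrite [schur _ _ _ _ _ _]mxE mulrCA [RHS]mulrC.
have F s : powmx (spec T a) (1 - s) *m X *m powmx (spec S b) s =
    T^t* *m schur (fun x y => x `^ (1 - s) * y `^ s) a b Z *m S.
  rewrite /powmx (fcalc_spec a _ uT) (fcalc_spec b _ uS) spec_mul_mul //.
  rewrite -/Z; set M := rdiag _ *m _ *m _; suff -> : M = schur (fun x y => x `^ (1 - s) * y `^ s) a b Z by [].
  apply/matrixP=> i j; rewrite [RHS]mxE mul_rdiagE rdiag_mulE mulrA -rmorphM.
  by rewrite /= [_ `^ s * _]mulrC.
have dg t x : derivable (fun s : R => a t.1 `^ (1 - s) * b t.2 `^ s) x 1.
  exact: derivable_geom_interp.
apply/matrixP=> k l; rewrite mxE entry.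
apply: complex_eqP => /=.
- under eq_Rintegral => s _.
    rewrite F entry Re_sum.
    under eq_bigr => t _ do rewrite mulrC ReZ mulrC.
    over.
  rewrite (Rintegral01_sum _ (fun t => complex.Re (w k l t)) dg).
  by rewrite Re_sum; apply: eq_bigr => t _; rewrite [in RHS]mulrC ReZ mulrC.
- under eq_Rintegral => s _.
    rewrite F entry Im_sum.
    under eq_bigr => t _ do rewrite mulrC ImZ mulrC.
    over.
  rewrite (Rintegral01_sum _ (fun t => complex.Im (w k l t)) dg).
  by rewrite Im_sum; apply: eq_bigr => t _; rewrite [in RHS]mulrC ImZ mulrC.
Qed.

Lemma poly_interpolation (K : fieldType) (f : K -> K) (s : seq K) :
  exists P : {poly K}, {in s, forall x, P.[x] = f x}.
Proof.
elim: s => [|x s [P HP]]; first by exists 0.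
have [xs|xs] := boolP (x \in s).
  by exists P => y; rewrite inE => /orP[/eqP ->|]; apply: HP.
pose V := \prod_(y <- s) ('X - y%:P).
have Vx : V.[x] != 0.
  by rewrite -[_ == 0]/(root V x) root_prod_XsubC.
exists (P + ((f x - P.[x]) / V.[x])%:P * V) => y; rewrite inE hornerD hornerM hornerC.
have [-> _|_ /= ys] := eqVneq y x; first by rewrite divfK // addrC subrK.
have /eqP -> : V.[y] == 0 by rewrite -[_ == 0]/(root V y) root_prod_XsubC.
by rewrite mulr0 addr0 HP.
Qed.

(** A function of a hermitian element of the algebra is a polynomial in it. *)
Lemma clifford_spec S b (f : R -> R) : S \is unitarymx -> clifford (spec S b) ->
  clifford (spec S (f \o b)).
Proof.
move=> uS cb; have [P HP] := poly_interpolation f (codom b).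
have -> : spec S (f \o b) = spec S (fun i => P.[b i]).
  by apply: eq_spec => i; rewrite /= HP // codom_f.
elim/poly_ind: P {HP} => [|P c IH].
  rewrite (eq_spec _ (v := fun=> 0)); last by move=> i; rewrite horner0.
  by rewrite spec_const //; apply: clifford_scalar.
rewrite (eq_spec _ (v := fun i => P.[b i] * b i + c)); last first.
  by move=> i; rewrite hornerMXaddC.
rewrite -(spec_add S (fun i => P.[b i] * b i) (fun=> c)) spec_const // -spec_mul //.
by apply: clifford_add; [exact: clifford_mul | exact: clifford_scalar].
Qed.

Section AtDensity.
Variables (S : op) (b : 'I_(hdim n) -> R).
Hypotheses (uS : S \is unitarymx) (b0 : forall i, 0 < b i).
Hypothesis cl : clifford (spec S b).
Let T := S *m p^t*.
Let uT : T \is unitarymx := unitary_mul_parity uS.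

Local Notation sharp1 X := (sharp (Gamma (spec S b)) (spec S b) X).

Lemma Gamma_spec : Gamma (spec S b) = spec T b.
Proof. by rewrite Gamma_clifford // /T spec_conj. Qed.

Lemma sharp_density X :
  sharp1 X = T^t* *m schur (@logmean R) b b (T *m X *m S^t*) *m S.
Proof. by rewrite Gamma_spec sharpE. Qed.

Lemma schurD f M M' : schur f b b (M + M') = schur f b b M + schur f b b M'.
Proof. by apply/matrixP=> i j; rewrite !mxE mulrDr. Qed.

Lemma schurZ f (k : C) M : schur f b b (k *: M) = k *: schur f b b M.
Proof. by apply/matrixP=> i j; rewrite !mxE mulrCA. Qed.

Lemma sharpD X Y : sharp1 (X + Y) = sharp1 X + sharp1 Y.
Proof. by rewrite !sharp_density mulmxDr mulmxDl schurD mulmxDr mulmxDl. Qed.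

Lemma sharpZ (k : C) X : sharp1 (k *: X) = k *: sharp1 X.
Proof.
by rewrite !sharp_density -scalemxAr -scalemxAl schurZ -scalemxAr -scalemxAl.
Qed.

Lemma hsdot_sharp X : hsdot X (sharp1 X) =
  \sum_i \sum_j logmean (b i) (b j) * sqmod ((T *m X *m S^t*) i j).
Proof.
rewrite -(hsdot_unitary _ _ uT uS) sharp_density unrotate_cancel // hsdotE.
apply: eq_bigr => i _; apply: eq_bigr => j _; rewrite [schur _ _ _ _ _ _]mxE ReZ ImZ /sqmod.
by rewrite mulrCA [X in _ + X]mulrCA -mulrDr !expr2.
Qed.

Lemma hsdot_sharp_ge0 X : 0 <= hsdot X (sharp1 X).
Proof.
rewrite hsdot_sharp; apply: sumr_ge0 => i _; apply: sumr_ge0 => j _.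
by rewrite mulr_ge0 ?sqmod_ge0 // ltW // logmean_gt0.
Qed.

Lemma hsdot_sharp_eq0 X : hsdot X (sharp1 X) = 0 -> X = 0.
Proof.
rewrite hsdot_sharp => /eqP.
have t0 i j : 0 <= logmean (b i) (b j) * sqmod ((T *m X *m S^t*) i j).
  by rewrite mulr_ge0 ?sqmod_ge0 // ltW // logmean_gt0.
rewrite psumr_eq0 => [/allP h|i _]; last by apply: sumr_ge0 => j _.
rewrite -(rotate_cancel X uS uT).
suff -> : T *m X *m S^t* = 0 by rewrite mulmx0 mul0mx.
apply/matrixP=> i j; rewrite [RHS]mxE; apply/eqP; rewrite -sqmod_eq0.
have := h i (mem_index_enum i); rewrite psumr_eq0 // => /allP/(_ j (mem_index_enum j)).
by rewrite mulf_eq0 gt_eqF // logmean_gt0.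
Qed.

(** Grouping by the distinct eigenvalues x of the density on the right, the
    logarithmic mean is a finite sum of products of functions of elements of
    the algebra. *)
Lemma clifford_sharp X : clifford X -> clifford (sharp1 X).
Proof.
move=> cX; pose s := undup (codom b).
have -> : sharp1 X = \sum_(x <- s)
    twist p (spec S ((fun y => logmean y x) \o b)) *m X *m
      spec S ((fun y => (y == x)%:R) \o b).
  rewrite sharp_density.
  under eq_bigr => x _ do rewrite /twist -spec_conj -/T (spec_mul_mul _ _ _ uS uT).
  rewrite -mulmx_suml -mulmx_sumr.
  set M := (X in T^t* *m X *m S); set M' := (X in _ = T^t* *m X *m S).
  suff -> : M = M' by [].
  apply/matrixP=> i j; rewrite mxE summxE.
  have bj : b j \in s by rewrite mem_undup codom_f.
  rewrite (bigD1_seq (b j)) ?undup_uniq //= big1 => [|x xb].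
    by rewrite mul_rdiagE rdiag_mulE /= eqxx mul1r addr0.
  by rewrite mul_rdiagE /= eq_sym (negPf xb) mul0r.
apply: clifford_sum => x _; apply: clifford_mul; last exact: clifford_spec.
by apply: clifford_mul => //; apply: clifford_twist_parity; apply: clifford_spec.
Qed.

Lemma clifford_log : clifford (logmx (spec S b)).
Proof. by rewrite /logmx fcalc_spec //; apply: clifford_spec. Qed.

(** The chain rule for the twisted derivation: the logarithmic mean of two
    eigenvalues turns their difference of logarithms into their difference. *)
Lemma sharp_grad_log k : sharp1 (grad1 k (logmx (spec S b))) = grad1 k (spec S b).
Proof.
have E : schur (@logmean R) b b (T *m grad1 k (logmx (spec S b)) *m S^t*) =
    T *m grad1 k (spec S b) *m S^t*.
  apply/matrixP=> i j; rewrite [LHS]mxE /logmx (fcalc_spec b (@ln R) uS).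
  rewrite [X in _ * X](rotated_half_grad (@ln R \o b) k i j uS).
  rewrite [RHS](rotated_half_grad b k i j uS).
  rewrite mulrA -rmorphM /= mulrA logmean_ln //.
rewrite sharp_density E; exact: rotate_cancel.
Qed.

Definition weighted_laplacian (U : op) : op := \sum_k div1 k (sharp1 (grad1 k U)).

Lemma weighted_laplacianD U V :
  weighted_laplacian (U + V) = weighted_laplacian U + weighted_laplacian V.
Proof.
rewrite -big_split; apply: eq_bigr => k _.
by rewrite half_gradD sharpD half_divD.
Qed.

Lemma weighted_laplacianZ (x : C) U : weighted_laplacian (x *: U) = x *: weighted_laplacian U.
Proof.
rewrite [RHS]scaler_sumr; apply: eq_bigr => k _.
by rewrite half_gradZ sharpZ half_divZ.
Qed.

Lemma gradE k V : clifford V -> grad V k = grad1 k V.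
Proof. by move=> cV; rewrite ffunE nabla_clifford. Qed.

Lemma div_gradient V : clifford V ->
  div (sharpn (Gamma (spec S b)) (spec S b) (grad V)) = - weighted_laplacian V.
Proof.
move=> cV; rewrite /div; congr (- _); apply: eq_bigr => k _.
rewrite ffunE (gradE k cV).
exact: nabla_adj_clifford (clifford_sharp (clifford_half_grad k cV)).
Qed.

Lemma weighted_laplacian_log :
  weighted_laplacian (logmx (spec S b)) = \sum_k div1 k (grad1 k (spec S b)).
Proof. by apply: eq_bigr => k _; rewrite sharp_grad_log. Qed.

(** The difference of two solutions is a gradient with zero weighted Laplacian;
    integrating by parts, its weighted norm vanishes, and the weight is
    positive definite. *)
Lemma tangent_gradient_unique v W W' :
  is_tangent_gradient (spec S b) v W -> is_tangent_gradient (spec S b) v W' -> W = W'.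
Proof.
move=> [[U cU ->] e] [[U' cU' ->] e'].
have cUU : clifford (U + (-1) *: U') by apply: clifford_add => //; apply: cliffordZ.
pose D k := grad1 k (U + (-1) *: U').
have DE k : D k = grad1 k U + (-1) *: grad1 k U' by rewrite /D half_gradD half_gradZ.
have sumD : \sum_k div1 k (sharp1 (D k)) = 0.
  rewrite -[LHS]/(weighted_laplacian _) weighted_laplacianD weighted_laplacianZ scaleN1r.
  have : v + - weighted_laplacian U = v + - weighted_laplacian U'.
    exact: (etrans (congr1 (+%R v) (esym (div_gradient cU)))
      (etrans e (etrans (esym e') (congr1 (+%R v) (div_gradient cU'))))).
  by move=> /addrI /oppr_inj ->; rewrite subrr.
have := congr1 (hsdot (U + (-1) *: U')) sumD.
rewrite hsdot_sumr => h.
have {h} : \sum_k hsdot (D k) (sharp1 (D k)) = 0.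
  under eq_bigr => k _ do rewrite {1}/D hsdot_grad.
  by rewrite h /hsdot mulmx0 mxtrace0.
move/eqP; rewrite psumr_eq0 => [/allP h|k _]; last exact: hsdot_sharp_ge0.
apply/ffunP => k; apply: etrans (gradE k cU) (etrans _ (esym (gradE k cU'))).
have /eqP/hsdot_sharp_eq0 := h k (mem_index_enum k).
by rewrite DE scaleN1r; apply: subr0_eq.
Qed.

(** By the chain rule the gradient of - c log rho solves the continuity equation for
    the velocity - c N rho. *)
Lemma metric_gradient_flow (c : R) (v : op) :
  v = - (c%:C *: \sum_k div1 k (grad1 k (spec S b))) ->
  metric (spec S b) v = 2 ^- n * fisher (spec S b) * c ^+ 2.
Proof.
move=> ev; pose U := (- c)%:C *: logmx (spec S b).
have cU : clifford U by apply: cliffordZ; apply: clifford_log.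
have gE k : grad U k = (- c)%:C *: grad1 k (logmx (spec S b)).
  by rewrite ffunE nabla_clifford // half_gradZ.
have sE k : sharp1 (grad U k) = (- c)%:C *: grad1 k (spec S b).
  by rewrite gE sharpZ sharp_grad_log.
have tg : is_tangent_gradient (spec S b) v (grad U).
  split; first by exists U.
  rewrite (div_gradient cU) /U weighted_laplacianZ weighted_laplacian_log.
  by rewrite ev rmorphN scaleNr opprK addNr.
have tgE : tangent_gradient (spec S b) v = grad U.
  refine (tangent_gradient_unique _ tg).
  exact: (@xgetPex _ 0 [set W | is_tangent_gradient (spec S b) v W] (ex_intro _ _ tg)).
rewrite /metric tgE Re_sum /fisher mulr_sumr mulr_suml; apply: eq_bigr => k _.
transitivity (2 ^- n * hsdot (grad U k) (sharp1 (grad U k))); first exact: Re_tau.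
rewrite sE gE hsdotZl hsdotZr; move: (hsdot _ _) => h; ring.
Qed.

End AtDensity.

(** * The curve from a density to the identity *)

Definition flow_poly (z : multi -> R) : {poly R} :=
  \sum_al z al *: (1 - 'X) ^+ degree al.

Lemma flow_poly_eval z t : (flow_poly z).[t] = \sum_al (1 - t) ^+ degree al * z al.
Proof.
rewrite horner_sum; apply: eq_bigr => al _.
by rewrite hornerZ horner_exp hornerD hornerN hornerX hornerC mulrC.
Qed.

Lemma flow_poly_deriv z t :
  (flow_poly z)^`().[t] = - \sum_al ((1 - t) ^+ (degree al).-1 *+ degree al) * z al.
Proof.
rewrite /flow_poly raddf_sum horner_sum -sumrN; apply: eq_bigr => al _ /=.
rewrite derivZ deriv_exp derivB derivC derivX sub0r hornerZ hornerMn hornerM hornerN.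
rewrite hornerC horner_exp hornerD hornerN hornerX hornerC mulN1r mulNrn mulrN.
by rewrite mulrC.
Qed.

Lemma scaled_entry (x : multi -> R) c k l :
  (\sum_al ((x al)%:C * c al) *: qpow q al) k l =
  \sum_al (x al)%:C * (c al * qpow q al k l).
Proof. by rewrite summxE; apply: eq_bigr => al _; rewrite mxE mulrA. Qed.

Lemma Re_flow c k l : (fun t => complex.Re (flow c (1 - t) k l)) =
  horner (flow_poly (fun al => complex.Re (c al * qpow q al k l))).
Proof.
apply/funext => t; rewrite /flow scaled_entry Re_sum flow_poly_eval.
by apply: eq_bigr => al _; rewrite ReZ.
Qed.

Lemma Im_flow c k l : (fun t => complex.Im (flow c (1 - t) k l)) =
  horner (flow_poly (fun al => complex.Im (c al * qpow q al k l))).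
Proof.
apply/funext => t; rewrite /flow scaled_entry Im_sum flow_poly_eval.
by apply: eq_bigr => al _; rewrite ImZ.
Qed.

Lemma derive1n_horner (P : {poly R}) k : exists P' : {poly R},
  ((horner P)^`(k))%classic = horner P'.
Proof.
elim: k => [|k [P' e]]; first by exists P; rewrite derive1n0.
by exists P'^`(); rewrite derive1nS e -derivE.
Qed.

Lemma smooth_flow c : smooth01 (fun t => flow c (1 - t)).
Proof.
move=> k l; split=> m t _; rewrite ?Re_flow ?Im_flow.
  by have [P ->] := derive1n_horner (flow_poly (fun al => complex.Re (c al * qpow q al k l))) m;
    apply: derivable_horner.
by have [P ->] := derive1n_horner (flow_poly (fun al => complex.Im (c al * qpow q al k l))) m;
  apply: derivable_horner.
Qed.

Lemma continuous_flow c : continuous01 (fun t => flow c (1 - t)).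
Proof.
move=> k l; rewrite Re_flow Im_flow.
by split; apply: within_itv_continuous => x; apply: derivable_horner.
Qed.

Lemma flow_velocity c t : 1 - t != 0 ->
  mxderive (fun t => flow c (1 - t)) t =
  - ((1 - t)^-1%:C *: \sum_k div1 k (grad1 k (flow c (1 - t)))).
Proof.
move=> r0; set r := 1 - t in r0 *.
have -> : - (r^-1%:C *: \sum_k div1 k (grad1 k (flow c r))) =
    - \sum_al ((r ^+ (degree al).-1 *+ degree al)%:C * c al) *: qpow q al.
  rewrite number_flow; congr (- _); rewrite scaler_sumr; apply: eq_bigr => al _.
  rewrite !scalerA mulrA -rmorphM; congr ((_%:C * _) *: _).
  case: (degree al) => [|k]; first by rewrite mulr0n mul0r mulr0.
  by rewrite /= -mulr_natl exprS; field.
apply/matrixP=> k l; rewrite [LHS]mxE [RHS]mxE Re_flow Im_flow -!derivE !flow_poly_deriv.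
rewrite scaled_entry; apply: complex_eqP => /=.
  have ReN (z : C) : complex.Re (- z) = - complex.Re z by case: z.
  by rewrite ReN Re_sum; congr (- _); apply: eq_bigr => al _; rewrite ReZ.
have ImN (z : C) : complex.Im (- z) = - complex.Im z by case: z.
by rewrite ImN Im_sum; congr (- _); apply: eq_bigr => al _; rewrite ImZ.
Qed.

(** Only the constant monomial survives at parameter 0, and its coefficient is
    the normalised trace. *)
Lemma flow0 c : tau (flow c 1) = 1 -> flow c 0 = 1%:M.
Proof.
pose al0 : multi := [ffun=> false].
have Q0 : qpow q al0 = 1%:M by rewrite /qpow big1 // => j _; rewrite ffunE expr0.
have d0 : degree al0 = 0 by rewrite /degree big1 // => j _; rewrite ffunE.
have E : flow c 0 = c al0 *: 1%:M.
  rewrite /flow (bigD1 al0) //= d0 expr0 mul1r Q0 big1 ?addr0 // => al al_neq.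
  rewrite expr0n; suff /negPf -> : degree al != 0 by rewrite mul0r scale0r.
  apply: contraNneq al_neq => /eqP; rewrite sum_nat_eq0 => /forallP h.
  by apply/eqP/ffunP => j; have := h j; rewrite ffunE; case: (al j).
rewrite /tau -(tr_mix 0) -flow_mix E mxtraceZ mxtrace1 => h.
suff -> : c al0 = 1 by rewrite scale1r.
have n0 : 2 ^+ n != 0 :> C by rewrite expf_neq0 // pnatr_eq0.
move: h; have -> : (hdim n)%:R = 2 ^+ n :> C by rewrite [X in X%:R]hdimE natrX.
by rewrite mulrCA mulVf // mulr1.
Qed.

End Fermions.

Theorem theorem4p3 (R : realType) (n : nat) (n_ge1 : (1 <= n)%N)
    (rho : 'M[R[i]]_(hdim n)) (rho_dens : density rho) :
  (dist rho 1%:M <= (Num.sqrt (2 * entropy rho))%:E)%E.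
Proof.
have [c rhoE] : exists c, rho = flow c 1.
  have [cl _ _ _] := rho_dens; have [c e] := clifford_inspan cl.
  by exists c; rewrite flow1.
rewrite rhoE in rho_dens *.
have dens := flow_density rho_dens.
pose G r := 2 ^- n * fisher (flow c r) / r ^+ 2.
have specP r : 0 <= r <= 1 -> exists S b,
    [/\ S \is unitarymx, flow c r = spec S b & forall i, 0 < b i].
  by move=> r01; have [_ pos unit _] := dens r r01; exact: positive_unit_spec pos unit.
have k0 : 0 <= 2 ^- n :> R by rewrite invr_ge0 exprn_ge0.
have G0 r : 0 <= r <= 1 -> 0 <= G r.
  move=> r01; have [S [b [uS e b0]]] := specP r r01.
  by rewrite /G e !mulr_ge0 ?fisher_ge0 // invr_ge0 exprn_ge0 //; case/andP: r01.
have Gmono r r' : 0 < r -> r <= r' -> r' <= 1 -> G r <= G r'.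
  move=> r0 rr' r'1; have r'0 := lt_le_trans r0 rr'.
  have r'01 : 0 <= r' <= 1 by rewrite (ltW r'0).
  have r01 : 0 <= r <= 1 by rewrite (ltW r0) (le_trans rr').
  have [S [b [uS eS b0]]] := specP r' r'01; have [T [d [uT eT d0]]] := specP r r01.
  pose x := r / r'; have x0 : 0 < x by rewrite divr_gt0.
  have x1 : x <= 1 by rewrite ler_pdivrMr // mul1r.
  have rE : r = x * r' by rewrite divfK // gt_eqF.
  rewrite rE in eT; have := fisher_mix x0 x1 uS uT b0 d0 eS eT; rewrite -rE => h.
  rewrite /G ler_pdivrMr ?exprn_gt0 //; apply: le_trans (ler_wpM2l k0 h) _.
  rewrite le_eqVlt; apply/orP; left; apply/eqP; rewrite /x expr_div_n.
  move: (fisher _) (2 ^- n) (r ^+ 2) ((r' ^+ 2)^-1) => F k y y'.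
  by ring.
(* The length estimate needs a speed that is monotone on the whole line, hence
   the extension by 0 on the left and by a constant on the right. *)
pose g r := if r <= 0 then 0 else Num.sqrt (G (Num.min r 1)).
have gE r : 0 < r <= 1 -> g r = Num.sqrt (G r).
  by move=> /andP[r0 r1]; rewrite /g leNgt r0 /= (min_idPl r1).
have g0 r : 0 <= g r by rewrite /g; case: ifP => _ //; apply: sqrtr_ge0.
have gmono : {homo g : x y / x <= y}.
  move=> x y xy; rewrite /g; case: (leP y 0) => y0; first by rewrite (le_trans xy y0).
  case: (leP x 0) => x0; first exact: sqrtr_ge0.
  apply: ler_wsqrtr; apply: Gmono.
  - by rewrite lt_min x0 ltr01.
  - by rewrite le_min !ge_min xy lexx orbT.
  - by rewrite ge_min lexx orbT.
have [K K0 grow] := entropy_flow_growth rho_dens.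
have bound := @length_le_sqrt R g (fun r => entropy (flow c r)) K K0 gmono g0
  (entropy_flow_ge0 rho_dens).
have adm : admissible (flow c 1) 1%:M (fun t => flow c (1 - t)).
  split.
  - by move=> t /andP[t0 t1]; apply: dens; rewrite subr_ge0 t1 gerBl.
  - exact: continuous_flow.
  - exact: smooth_flow.
  - by rewrite subr0.
  - by rewrite subrr flow0 //; case: rho_dens.
apply: le_trans (ereal_inf_lbound _) _; first by exists (fun t => flow c (1 - t)).
have -> : curve_length (fun t => flow c (1 - t)) =
    (\int[lebesgue_measure]_(u in `]0%R, 1%R[) (g (1 - u))%:E)%E.
  apply: eq_integral => u; rewrite inE /= in_itv /= => /andP[u0 u1].
  have r0 : 0 < 1 - u by rewrite subr_gt0.
  have r1 : 1 - u <= 1 by rewrite gerBl ltW.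
  have r01 : 0 <= 1 - u <= 1 by rewrite (ltW r0).
  rewrite gE ?r0 //; congr (Num.sqrt _)%:E.
  have [S [b [uS e b0]]] := specP _ r01.
  have cl := clifford_flow c (1 - u).
  rewrite flow_velocity ?gt_eqF //; rewrite e in cl *.
  by rewrite (metric_gradient_flow uS b0 cl erefl) /G e exprVn.
apply: bound => r r' r0 rr' r'1.
have r01 : 0 <= r <= 1 by rewrite (ltW r0) (le_trans rr').
rewrite gE ?r0 ?(le_trans rr') // sqr_sqrtr ?G0 //.
exact: grow.
Qed.
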